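(* Let $L$ be a standard Levi subgroup of $\mathrm{GL}_n(\mathbf k)$. There exists a monomial ideal $I\subset\mathbf k[x_1,\dots,x_n]$ with cofinite support and $x_i\notin I$ for all $i$ such that the automorphism group $G=\operatorname{Aut}_{\mathbf k}(\mathbf k[x_1,\dots,x_n]/I)$ satisfies $G_1^0\simeq L$. The same holds if $L$ is replaced by the standard parabolic subgroup $P_L$, i.e. there also exists such an ideal $I$ with $G_1^0\simeq P_L$. In particular, in both cases the Levi subgroup of $G$ (the reductive group in a decomposition of $G^0$ as the semidirect product of its unipotent radical and a reductive subgroup) is $L$ (up to isomorphism).
   Context: $\mathbf k$ is an algebraically closed field of characteristic zero. A standard Levi subgroup of $\mathrm{GL}_n(\mathbf k)$ is a subgroup of block diagonal matrices $\prod_{j=1}^r\mathrm{GL}_{m_j}(\mathbf k)$ for a composition $n=m_1+\dots+m_r$; the corresponding standard parabolic is $P_L=\langle L,U_n\rangle$, with $U_n$ the group of unipotent upper triangular matrices. A monomial ideal $I$ has cofinite support if only finitely many monomials lie outside $I$. For a monomial ideal $I\subset\mathbf k[x_1,\dots,x_n]$ with cofinite support and $x_i\notin I$, put $A=\mathbf k[x_1,\dots,x_n]/I$. $G=\operatorname{Aut}_{\mathbf k}(A)$ is a linear algebraic group; $T\subset G$ is the maximal torus acting by $\overline x_i\mapsto t_i\overline x_i$; a toric automorphism is an automorphism $\overline x_k\mapsto\overline x_{\sigma(k)}$ for a permutation $\sigma\in S_n$ preserving $I$. For $i\neq j$, the degree $\alpha=e_i-e_j\in\mathbb Z^n$ is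 a root of degree-sum zero if the derivation $x_i\,\partial/\partial x_j$ of $\mathbf k[x_1,\dots,x_n]$ preserves $I$; then $U_\alpha\subset G$ is the one-parameter group $\{\exp(t\,\overline\partial_\alpha):t\in\mathbf k\}$, where $\overline\partial_\alpha$ is the derivation of $A$ induced by $x_i\,\partial/\partial x_j$. $G_1$ is the subgroup of $G$ generated by $T$, the toric automorphisms and these $U_\alpha$; $G_1^0$ is its identity component. *)

(* Defs.v *)
From mathcomp Require Import all_boot all_order all_algebra all_fingroup.
From mathcomp Require Import generic_quotient ring_quotient.
From mathcomp Require Import classical_sets.
From mathcomp Require Import mpoly.

Set Implicit Arguments.
Unset Strict Implicit.
Unset Printing Implicit Defensive.

Import GRing.Theory.

Local Open Scope classical_set_scope.
Local Open Scope quotient_scope.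
Local Open Scope ring_scope.

Section LinearGroups.
Variable k : fieldType.

(* The N * N variables stand for the matrix entries, in the order of [mxvec]. *)
Definition mxeval (N : nat) (p : {mpoly k[N * N]}) (x : 'M[k]_N) : k :=
  p.@[fun i => mxvec x 0 i].

Definition zariski_closed (N : nat) (Z : set 'M[k]_N) : Prop :=
  exists S : set {mpoly k[N * N]}, Z = [set x | forall p, S p -> mxeval p x = 0].

(* Connectedness for the topology induced on [X] by the Zariski topology. *)
Definition zariski_connected (N : nat) (X : set 'M[k]_N) : Prop :=
  forall Z1 Z2 : set 'M[k]_N, zariski_closed Z1 -> zariski_closed Z2 ->
    X `<=` Z1 `|` Z2 -> X `&` Z1 `&` Z2 = set0 ->
    X `&` Z1 = set0 \/ X `&` Z2 = set0.

Definition is_subgroup (N : nat) (H : set 'M[k]_N) : Prop :=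
  [/\ H `<=` [set x | x \in unitmx],
      H 1%:M,
      forall x y, H x -> H y -> H (x *m y)
    & forall x, H x -> H (invmx x)].

Definition generated (N : nat) (S : set 'M[k]_N) : set 'M[k]_N :=
  [set x | forall H, is_subgroup H -> S `<=` H -> H x].

Definition is_closed_subgroup (N : nat) (H : set 'M[k]_N) : Prop :=
  is_subgroup H /\
  exists2 Z, zariski_closed Z & H = Z `&` [set x | x \in unitmx].

Definition identity_component (N : nat) (H : set 'M[k]_N) : set 'M[k]_N :=
  [set x | exists X, [/\ X `<=` H, zariski_connected X, X 1%:M & X x]].

(* Restrictions to [H] of elements of k[GL_N] = k[x_ij, 1/det]. *)
Definition regular_on (N : nat) (H : set 'M[k]_N) (f : 'M[k]_N -> k) : Prop :=
  exists (p : {mpoly k[N * N]}) (e : nat),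
    forall x, H x -> f x = mxeval p x / \det x ^+ e.

Definition regular_map_on (N N' : nat) (H : set 'M[k]_N)
    (f : 'M[k]_N -> 'M[k]_N') : Prop :=
  forall i j, regular_on H (fun x => f x i j).

Definition alg_iso (N N' : nat) (H : set 'M[k]_N) (K : set 'M[k]_N') : Prop :=
  exists (f : 'M[k]_N -> 'M[k]_N') (g : 'M[k]_N' -> 'M[k]_N),
    [/\ regular_map_on H f /\ regular_map_on K g,
        forall x, H x -> K (f x),
        forall y, K y -> H (g y),
        forall x y, H x -> H y -> f (x *m y) = f x *m f y
      & (forall x, H x -> g (f x) = x) /\ (forall y, K y -> f (g y) = y)].

Definition is_unipotent (N : nat) (H : set 'M[k]_N) : Prop :=
  forall x, H x -> exists l : nat, (x - 1%:M) ^+ l = 0.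

Definition is_normal_in (N : nat) (U H : set 'M[k]_N) : Prop :=
  U `<=` H /\ forall x u, H x -> U u -> U (x *m u *m invmx x).

Definition connected_normal_unipotent (N : nat) (H U : set 'M[k]_N) : Prop :=
  [/\ is_closed_subgroup U, zariski_connected U, is_normal_in U H
    & is_unipotent U].

Definition is_unipotent_radical (N : nat) (H U : set 'M[k]_N) : Prop :=
  connected_normal_unipotent H U /\
  forall V, connected_normal_unipotent H V -> V `<=` U.

Definition is_reductive (N : nat) (H : set 'M[k]_N) : Prop :=
  is_closed_subgroup H /\ is_unipotent_radical H [set 1%:M].

(* H = U ><| M as algebraic groups: the projection [q] of H onto M along U is
   required to be regular, so that the product map U x M -> H is an isomorphism
   of varieties, with inverse x |-> (x q(x)^-1, q(x)). *)
Definition is_semidirect_product (N : nat) (H U M : set 'M[k]_N) : Prop :=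
  [/\ is_normal_in U H, M `<=` H, U `&` M = [set 1%:M]
    & exists2 q : 'M[k]_N -> 'M[k]_N, regular_map_on H q &
        forall x, H x -> M (q x) /\ U (x *m invmx (q x))].

Definition is_levi_subgroup (N : nat) (G M : set 'M[k]_N) : Prop :=
  is_reductive M /\
  exists2 U, is_unipotent_radical (identity_component G) U &
             is_semidirect_product (identity_component G) U M.

(* Levi subgroups of G are only defined up to conjugation, so "the Levi
   subgroup of G is L" means that there is one and that each one is isomorphic
   to L. *)
Definition levi_subgroup_iso (N N' : nat) (G : set 'M[k]_N)
    (L : set 'M[k]_N') : Prop :=
  (exists M, is_levi_subgroup G M) /\
  (forall M, is_levi_subgroup G M -> alg_iso M L).

(* For nilpotent D one has D ^+ N = 0, so this is the full exponential. *)
Definition nilpotent_exp (N : nat) (D : 'M[k]_N) : 'M[k]_N :=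
  \sum_(l < N) (l`!%:R)^-1 *: D ^+ l.

Section StandardSubgroups.
Variables (r : nat) (m : 'I_r -> nat).

Definition standard_levi : set 'M[k]_(\sum_j m j) :=
  [set x | exists2 B : forall j, 'M[k]_(m j),
             (forall j, B j \in unitmx) & x = \mxdiag_(j < r) B j].

Definition upper_unipotent (n : nat) : set 'M[k]_n :=
  [set x | (forall i, x i i = 1) /\ (forall i j : 'I_n, (j < i)%N -> x i j = 0)].

Definition standard_parabolic : set 'M[k]_(\sum_j m j) :=
  generated (standard_levi `|` @upper_unipotent _).

End StandardSubgroups.
End LinearGroups.

Arguments standard_levi k {r} m.
Arguments standard_parabolic k {r} m.

Section MonomialIdeals.
Variables (k : fieldType) (n : nat).
Implicit Types (I : idealr {mpoly k[n]}) (B : seq 'X_{1..n}).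

Definition monomial_ideal I : Prop :=
  exists S : set 'X_{1..n}, forall p : {mpoly k[n]},
    p \in I <->
    exists2 s : seq ({mpoly k[n]} * 'X_{1..n}),
      (forall c, c \in s -> S c.2) & p = \sum_(c <- s) c.1 * 'X_[c.2].

Definition cofinite_support I : Prop :=
  exists B, forall e : 'X_{1..n}, 'X_[e] \notin I -> e \in B.

(* The classes of the monomials listed by [B] form a basis of k[x]/I. *)
Definition standard_monomials I B : Prop :=
  uniq B /\ forall e : 'X_{1..n}, (e \in B) = ('X_[e] \notin I).

Section Quotient.
Variables (I : idealr {mpoly k[n]}) (B : seq 'X_{1..n}).
Local Notation A := {ideal_quot I}.
Local Notation N := (size B).

(* Column j of M gives f of the j-th basis monomial. *)
Definition is_matrix_of (f : A -> A) (M : 'M[k]_N) : Prop :=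
  forall j : 'I_N, f (\pi_A 'X_[tnth (in_tuple B) j])
                   = \pi_A (\sum_i M i j *: 'X_[tnth (in_tuple B) i]).

Definition is_algebra_automorphism (f : {rmorphism A -> A}) : Prop :=
  bijective f /\ forall c : k, f (\pi_A c%:MP) = \pi_A c%:MP.

Definition AutA : set 'M[k]_N :=
  [set M | exists2 f, is_algebra_automorphism f & is_matrix_of f M].

Definition torusA : set 'M[k]_N :=
  [set M | exists f (t : 'I_n -> k),
     [/\ is_algebra_automorphism f, is_matrix_of f M,
         forall i, t i != 0
       & forall i, f (\pi_A 'X_i) = \pi_A (t i *: 'X_i)]].

Definition toricA : set 'M[k]_N :=
  [set M | exists f (s : 'S_n),
     [/\ is_algebra_automorphism f, is_matrix_of f M,
         forall p, p \in I -> p \mPo [tuple 'X_(s i) | i < n] \in I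
       & forall i, f (\pi_A 'X_i) = \pi_A 'X_(s i)]].

(* The root is e_i - e_j, with derivation x_i d/dx_j. *)
Definition is_root0 (i j : 'I_n) : Prop :=
  i != j /\ forall p, p \in I -> 'X_i * p^`M(j) \in I.

Definition rootA (i j : 'I_n) : set 'M[k]_N :=
  [set M | exists (d : A -> A) (D : 'M[k]_N) (t : k),
     [/\ forall p, d (\pi_A p) = \pi_A ('X_i * p^`M(j)),
         is_matrix_of d D & M = nilpotent_exp (t *: D)]].

Definition G1 : set 'M[k]_N :=
  generated (torusA `|` toricA `|` [set M | exists i j, is_root0 i j /\ rootA i j M]).

End Quotient.
End MonomialIdeals.

Arguments AutA {k n} I B.
Arguments G1 {k n} I B.

(* Main.v *)
From HB Require Import structures.
Require Import Defs.
From mathcomp Require Import all_boot all_order all_algebra all_fingroup.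
From mathcomp Require Import generic_quotient ring_quotient.
From mathcomp Require Import zify.
From mathcomp Require Import boolp classical_sets mpoly.

(** For a symmetric relation e on the variables let I be spanned by all
    monomials of degree at least 3 together with the products x_i x_j such
    that e i j, and let A = k[x]/I.  As A lives in degrees 0, 1 and 2, an
    endomorphism x_j |-> y_j of A without constant terms is given by a matrix
    g, the linear parts of the y_j, and by quadratic terms, which are free:
    they change a product y_i y_j only in degrees where everything lies in I.
    So Aut A is the group of the pairs (g, q) where q is arbitrary and g
    preserves the span of the quadratic relations.

    The degree e_i - e_j is a root iff e j c implies e i c for all c; this is
    a preorder on the variables (root_le).  Call H the group of the invertible
    matrices with support in this preorder.  All its elements preserve I, and
    elimination shows that it is generated by diagonal matrices and
    transvections (supported_unit_gen); hence H, acting linearly on A, lies in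
    G_1.  It is an open subset of a vector space, so it is connected: a
    polynomial that does not vanish on it does not vanish identically on some
    line joining two of its points (zariski_connected_affine_open).

    Suppose that, conversely, connected sets of automorphisms through the
    identity have their linear parts in H.  Then G_1^0 is H, and Aut(A)^0 is
    the set of the pairs (g, q) with g in H.  Suppose moreover that the
    equivalence classes of the preorder are the blocks of variables and that
    the preorder is compatible with the order of the blocks.  Taking the block
    diagonal part of g is then a homomorphism from Aut(A)^0 onto L, split by
    the linear action of L.  Its kernel is unipotent, because for suitable
    weights of the variables it adds to each x_j only terms of larger weight
    (unipotent_autos_unipotent).  Since L has no nontrivial normal subgroup
    made of unipotent matrices (normal_unipotent_block_diag), the kernel is
    the unipotent radical, and L is a Levi subgroup.  Any other Levi subgroup
    is a complement of the same radical, hence isomorphic to L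
    (complements_iso).

    It remains to choose e.
    - For L, let e relate the variables of the same block.  The relation
      x_j^2 = 0 forces the linear part of the image of x_j to involve only one
      block; which one is locally constant, so in a connected set containing
      the identity it is the block of j (same_block_component).
    - For P_L, number the r blocks from 0 and let e i j mean that the numbers
      of the blocks of i and j add up to less than r.  A linear form whose
      last variable lies in block a is annihilated in A exactly by the linear
      forms in the blocks below r - a.  As automorphisms preserve the
      dimension of annihilators, their linear parts are block upper triangular
      (threshold_linear_part). *)
Set Implicit Arguments.
Unset Strict Implicit.
Unset Printing Implicit Defensive.

Import GRing.Theory.
Local Open Scope classical_set_scope.
Local Open Scope quotient_scope.
Local Open Scope ring_scope.

(** * Polynomial functions and the Zariski topology on matrices *)

Section FunctionAlgebras.
Variables (k : fieldType) (T : Type) (P : (T -> k) -> Prop).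

(** Shared by polynomial functions, by regular functions on a subgroup and by
    functions that are polynomial in one parameter, so that closure under
    determinants, adjugates and evaluation of polynomials is proved once. *)
Definition is_function_algebra : Prop :=
  [/\ forall c, P (fun=> c),
      forall f g, P f -> P g -> P (fun x => f x + g x)
    & forall f g, P f -> P g -> P (fun x => f x * g x)].

Hypothesis Palg : is_function_algebra.

Lemma function_algebra_cst c : P (fun=> c).
Proof. by case: Palg. Qed.

Lemma function_algebraD f g : P f -> P g -> P (fun x => f x + g x).
Proof. by case: Palg => _ + _; apply. Qed.

Lemma function_algebraM f g : P f -> P g -> P (fun x => f x * g x).
Proof. by case: Palg => _ _; apply. Qed.

Lemma function_algebra_sum I (s : seq I) (c : pred I) (F : I -> T -> k) :
  (forall i, c i -> P (F i)) -> P (fun x => \sum_(i <- s | c i) F i x).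
Proof.
move=> PF; elim: s => [|i s IHs].
  by under eq_fun do rewrite big_nil; apply: function_algebra_cst.
under eq_fun do rewrite big_cons; case ci: (c i) => //.
by apply: function_algebraD => //; apply: PF.
Qed.

Lemma function_algebra_prod I (s : seq I) (c : pred I) (F : I -> T -> k) :
  (forall i, c i -> P (F i)) -> P (fun x => \prod_(i <- s | c i) F i x).
Proof.
move=> PF; elim: s => [|i s IHs].
  by under eq_fun do rewrite big_nil; apply: function_algebra_cst.
under eq_fun do rewrite big_cons; case ci: (c i) => //.
by apply: function_algebraM => //; apply: PF.
Qed.

Lemma function_algebraX f n : P f -> P (fun x => f x ^+ n).
Proof.
move=> Pf; elim: n => [|n IHn].
  by under eq_fun do rewrite expr0; apply: function_algebra_cst.
by under eq_fun do rewrite exprS; apply: function_algebraM.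
Qed.

Lemma function_algebra_det n (F : T -> 'M[k]_n) :
  (forall i j, P (fun x => F x i j)) -> P (fun x => \det (F x)).
Proof.
move=> PF; apply: function_algebra_sum => s _; apply: function_algebraM.
  exact: function_algebra_cst.
exact: function_algebra_prod.
Qed.

Lemma function_algebra_adj n (F : T -> 'M[k]_n) i j :
  (forall i j, P (fun x => F x i j)) -> P (fun x => (\adj (F x)) i j).
Proof.
move=> PF; under eq_fun do rewrite mxE; apply: function_algebraM.
  exact: function_algebra_cst.
apply: function_algebra_det => i' j'; under eq_fun do rewrite !mxE.
exact: PF.
Qed.

Lemma function_algebra_mxeval n (F : T -> 'M[k]_n) (p : {mpoly k[n * n]}) :
  (forall i j, P (fun x => F x i j)) -> P (fun x => mxeval p (F x)).
Proof.
move=> PF; rewrite /mxeval; under eq_fun do rewrite mevalE.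
apply: function_algebra_sum => m _; apply: function_algebraM.
  exact: function_algebra_cst.
apply: function_algebra_prod => l _; apply: function_algebraX.
by case/mxvec_indexP: l => i j; under eq_fun do rewrite mxvecE; apply: PF.
Qed.

End FunctionAlgebras.

Section PolynomialFunctions.
Variable k : fieldType.

Definition polynomial_fun N (f : 'M[k]_N -> k) : Prop :=
  exists p : {mpoly k[N * N]}, f = mxeval p.

Definition polynomial_map N N' (F : 'M[k]_N -> 'M[k]_N') : Prop :=
  forall i j, polynomial_fun (fun x => F x i j).

Lemma polynomial_fun_algebra N : is_function_algebra (@polynomial_fun N).
Proof.
split=> [c|_ _ [p ->] [q ->]|_ _ [p ->] [q ->]].
- by exists c%:MP; apply/funext => x; rewrite /mxeval mevalC.
- by exists (p + q); apply/funext => x; rewrite /mxeval mevalD.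
- by exists (p * q); apply/funext => x; rewrite /mxeval mevalM.
Qed.

Lemma polynomial_fun_entry N i j : polynomial_fun (fun x : 'M[k]_N => x i j).
Proof.
exists 'X_(mxvec_index i j); apply/funext => x.
by rewrite /mxeval mevalXU mxvecE.
Qed.

Lemma polynomial_fun_comp N N' (F : 'M[k]_N -> 'M[k]_N') f :
  polynomial_map F -> polynomial_fun f -> polynomial_fun (fun x => f (F x)).
Proof.
move=> FP [p ->].
exact: (function_algebra_mxeval (@polynomial_fun_algebra N)).
Qed.

Lemma polynomial_map_comp N N' N'' (F : 'M[k]_N -> 'M[k]_N')
    (F1 : 'M[k]_N' -> 'M[k]_N'') :
  polynomial_map F -> polynomial_map F1 -> polynomial_map (fun x => F1 (F x)).
Proof. by move=> FP F1P i j; apply: (polynomial_fun_comp (f := fun y => F1 y i j)). Qed.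

Lemma polynomial_fun_det N : polynomial_fun (fun x : 'M[k]_N => \det x).
Proof.
apply: (function_algebra_det (@polynomial_fun_algebra N)) => i j.
exact: polynomial_fun_entry.
Qed.

(** Restricting to a line reduces nonvanishing statements to polynomials in one
    variable. *)
Lemma polynomial_fun_line N (f : 'M[k]_N -> k) x y : polynomial_fun f ->
  exists q : {poly k}, forall t, q.[t] = f (x + t *: (y - x)).
Proof.
case=> p ->.
have Qalg : is_function_algebra
    (fun g : k -> k => exists q : {poly k}, forall t, q.[t] = g t).
  split=> [c|g h [q gE] [q' hE]|g h [q gE] [q' hE]].
  - by exists c%:P => t; rewrite hornerC.
  - by exists (q + q') => t; rewrite hornerD gE hE.
  - by exists (q * q') => t; rewrite hornerM gE hE.
apply: (function_algebra_mxeval Qalg) => i j.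
exists ((x i j)%:P + 'X * (y i j - x i j)%:P) => t.
by rewrite !hornerE !mxE.
Qed.

Lemma zariski_closed_zeros N I (D : set I) (f : I -> 'M[k]_N -> k) :
  (forall i, D i -> polynomial_fun (f i)) ->
  zariski_closed [set x | forall i, D i -> f i x = 0].
Proof.
move=> fP; exists [set p | exists2 i, D i & f i = mxeval p].
apply/seteqP; split=> x /= fx0.
  by move=> p [i Di <-]; apply: fx0.
by move=> i Di; have [p pE] := fP i Di; rewrite pE; apply: fx0; exists i.
Qed.

Lemma zariski_closed_preimage N N' (F : 'M[k]_N -> 'M[k]_N') Z :
  polynomial_map F -> zariski_closed Z -> zariski_closed (F @^-1` Z).
Proof.
move=> FP [S ->].
rewrite [X in zariski_closed X](_ : _ =
  [set x | forall p, S p -> mxeval p (F x) = 0]) //.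
by apply: zariski_closed_zeros => p _; apply: polynomial_fun_comp => //; exists p.
Qed.

Lemma zariski_connected_set1 N (x : 'M[k]_N) : zariski_connected [set x].
Proof.
move=> Z1 Z2 _ _ sub dis.
have [Z1x|Z2x] := sub x erefl.
  right; rewrite -subset0 => _ [-> Z2x].
  by have : set0 x by rewrite -dis.
left; rewrite -subset0 => _ [-> Z1x].
by have : set0 x by rewrite -dis.
Qed.

(** X is the union of its disjoint relatively closed parts in Z1 and Z2, and
    the first one is not empty. *)
Lemma zariski_connected_sub N (X Z1 Z2 : set 'M[k]_N) x0 :
  zariski_connected X -> zariski_closed Z1 -> zariski_closed Z2 ->
  X `<=` Z1 `|` Z2 -> X `&` Z1 `&` Z2 = set0 -> X x0 -> Z1 x0 -> X `<=` Z1.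
Proof.
move=> Xconn Z1c Z2c sub dis Xx0 Z1x0 x Xx.
have [e|e] := Xconn _ _ Z1c Z2c sub dis.
  by have : set0 x0 by rewrite -e.
by have [//|Z2x] := sub x Xx; have : set0 x by rewrite -e.
Qed.

End PolynomialFunctions.

Lemma closed_sub_identity_component (k : fieldType) N (G X : set 'M[k]_N) :
  X `<=` G -> zariski_connected X -> X 1%:M -> X `<=` identity_component G.
Proof. by move=> XG Xc X1 x Xx; exists X. Qed.

(** If a and b in the image lie in only one of the two closed sets each, then
    some p1 does not vanish at b and some p2 does not vanish at a, although p1
    p2 vanishes on the image. On the line through preimages of a and b the
    three functions D, p1 and p2 are nonzero polynomials in one variable, so
    they are simultaneously nonzero at some point. *)
Lemma zariski_connected_affine_open (k : closedFieldType) N N'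
    (F : 'M[k]_N -> 'M[k]_N') (W : set 'M[k]_N) (D : 'M[k]_N -> k) :
  polynomial_map F -> polynomial_fun D ->
  (forall x y t, W x -> W y -> W (x + t *: (y - x))) ->
  zariski_connected (F @` (W `&` [set x | D x != 0])).
Proof.
move=> FP DP Waff Z1 Z2 [S1 ->] [S2 ->] sub dis.
set X := F @` _ in sub dis *.
case: (pselect (X `&` [set x | forall p, S1 p -> mxeval p x = 0] = set0)).
  by left.
move/eqP/set0P => [_ [[a [Wa Da] <-] Z1a]].
case: (pselect (X `&` [set x | forall p, S2 p -> mxeval p x = 0] = set0)).
  by right.
move/eqP/set0P => [_ [[b [Wb Db] <-] Z2b]].
have Xa : X (F a) by exists a.
have Xb : X (F b) by exists b.
have [p2 [S2p p2a]] : exists p, S2 p /\ mxeval p (F a) != 0.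
  apply: contrapT => H.
  have : set0 (F a) by rewrite -dis; split=> // p Sp; apply/eqP;
    apply: contraPT H => pa; apply; exists p.
  by [].
have [p1 [S1p p1b]] : exists p, S1 p /\ mxeval p (F b) != 0.
  apply: contrapT => H.
  have : set0 (F b) by rewrite -dis; split=> //; split=> // p Sp; apply/eqP;
    apply: contraPT H => pa; apply; exists p.
  by [].
have mxP n p : polynomial_fun (mxeval p : 'M[k]_n -> k) by exists p.
have [q2 q2E] := polynomial_fun_line a b (polynomial_fun_comp FP (mxP _ p2)).
have [q1 q1E] := polynomial_fun_line a b (polynomial_fun_comp FP (mxP _ p1)).
have [q qE] := polynomial_fun_line a b DP.
have l0 : a + 0 *: (b - a) = a by rewrite scale0r addr0.
have l1 : a + 1 *: (b - a) = b by rewrite scale1r addrC subrK.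
have nz (p : {poly k}) t : p.[t] != 0 -> p != 0.
  by apply: contraNneq => ->; rewrite horner0.
have /closed_nonrootP [t] : q1 * q2 * q != 0.
  rewrite !mulf_neq0 //; first by apply: (nz _ 1); rewrite q1E l1.
    by apply: (nz _ 0); rewrite q2E l0.
  by apply: (nz _ 0); rewrite qE l0.
rewrite /root !hornerM !mulf_eq0 !negb_or q1E q2E qE => /andP[/andP[t1 t2] tD].
have : X (F (a + t *: (b - a))) by exists (a + t *: (b - a)); split=> //; apply: Waff.
move=> /sub [/(_ _ S1p)|/(_ _ S2p)] /eqP; first by rewrite (negPf t1).
by rewrite (negPf t2).
Qed.

Section RegularMaps.
Variable k : fieldType.

Lemma regular_on_subset N (H K : set 'M[k]_N) f :
  H `<=` K -> regular_on K f -> regular_on H f.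
Proof. by move=> HK [p [e fE]]; exists p, e => x /HK /fE. Qed.

Lemma polynomial_regular_on N (H : set 'M[k]_N) f :
  polynomial_fun f -> regular_on H f.
Proof. by case=> p ->; exists p, 0%N => x _; rewrite expr0 divr1. Qed.

Lemma regular_on_algebra N (H : set 'M[k]_N) :
  H `<=` [set x | x \in unitmx] -> is_function_algebra (regular_on H).
Proof.
move=> Hunit; have [d dE] := @polynomial_fun_det k N.
have dP x : mxeval d x = \det x by rewrite -dE.
have det0 x : H x -> \det x != 0 by move/Hunit; rewrite /= unitmxE unitfE.
split=> [c|f g [p [e fE]] [q [e' gE]]|f g [p [e fE]] [q [e' gE]]].
- apply: polynomial_regular_on.
  exact: function_algebra_cst (@polynomial_fun_algebra _ _) _.
- exists (p * d ^+ e' + q * d ^+ e), (e + e')%N => x Hx.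
  rewrite fE // gE // [mxeval (_ + _) _]mevalD !mevalM !rmorphXn /=.
  rewrite -/(mxeval p x) -/(mxeval q x) -/(mxeval d x) dP exprD.
  by rewrite addf_div ?expf_neq0 ?det0.
- exists (p * q), (e + e')%N => x Hx.
  by rewrite fE // gE // [mxeval (_ * _) _]mevalM exprD mulf_div.
Qed.

Lemma regular_on_invmx N (H : set 'M[k]_N) i j :
  H `<=` [set x | x \in unitmx] -> regular_on H (fun x => invmx x i j).
Proof.
move=> Hunit.
have [p pE] := function_algebra_adj (@polynomial_fun_algebra _ _) i j
  (@polynomial_fun_entry k N).
exists p, 1%N => x /Hunit /= xu.
by rewrite /invmx xu mxE expr1 mulrC -pE.
Qed.

(** The denominator det(x^-1)^e turns into the polynomial det(x)^e, and the
    entries of x^-1 are regular. *)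
Lemma regular_on_comp_invmx N (H : set 'M[k]_N) : is_subgroup H ->
  forall f, regular_on H f -> regular_on H (fun x => f (invmx x)).
Proof.
move=> [Hunit _ _ Hinv] f [p [e fE]].
suff [q [e' qE]] : regular_on H (fun x => mxeval p (invmx x) * \det x ^+ e).
  exists q, e' => x Hx; rewrite fE ?qE; last by apply: Hinv.
  by rewrite -qE // det_inv exprVn invrK.
have Ralg := regular_on_algebra Hunit.
apply: (function_algebraM Ralg).
  by apply: (function_algebra_mxeval Ralg) => i j; apply: regular_on_invmx.
apply: (function_algebraX Ralg); apply: polynomial_regular_on.
exact: polynomial_fun_det.
Qed.

(** A denominator det(f x) need not be a power of det x, but its inverse is
    det(f(x^-1)), which is regular. *)
Lemma regular_on_comp N N' (H : set 'M[k]_N) (K : set 'M[k]_N') f h :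
  is_subgroup H -> is_subgroup K -> regular_map_on H f ->
  (forall x, H x -> K (f x)) ->
  (forall x y, H x -> H y -> f (x *m y) = f x *m f y) ->
  regular_on K h -> regular_on H (fun x => h (f x)).
Proof.
move=> Hg [Kunit _ _ _] fR fK fM [p [e hE]].
have [Hunit H1 HM Hinv] := Hg.
have f1 : f 1%:M = 1%:M.
  have fu := Kunit _ (fK _ H1).
  by have := fM _ _ H1 H1; rewrite mulmx1 => /(congr1 (mulmx (invmx (f 1%:M))));
    rewrite mulKmx // mulVmx.
have dV x : H x -> \det (f (invmx x)) = (\det (f x))^-1.
  move=> Hx; have /= fu := Kunit _ (fK _ Hx).
  have : \det (f x) * \det (f (invmx x)) = 1.
    by rewrite -det_mulmx -fM ?mulmxV ?f1 ?det1 //; [apply: Hunit | apply: Hinv].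
  have d0 : \det (f x) != 0 by rewrite -unitfE -unitmxE.
  by move=> dd; apply: (mulfI d0); rewrite dd divff.
have Ralg := regular_on_algebra Hunit.
suff [q [e' qE]] : regular_on H
    (fun x => mxeval p (f x) * \det (f (invmx x)) ^+ e).
  exists q, e' => x Hx; rewrite hE ?qE; last by apply: fK.
  by rewrite -qE // dV // exprVn.
apply: (function_algebraM Ralg).
  exact: (function_algebra_mxeval Ralg).
apply: (function_algebraX Ralg).
apply: (function_algebra_det Ralg) => i j.
by apply: (regular_on_comp_invmx Hg (f := fun x => f x i j)).
Qed.

Lemma alg_iso_sym N N' (H : set 'M[k]_N) (K : set 'M[k]_N') :
  is_subgroup H -> alg_iso H K -> alg_iso K H.
Proof.
move=> [_ _ HM _] [f [g [[fR gR] fK gH fM [gf fg]]]].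
exists g, f; split=> // x y Kx Ky.
have [Hx Hy] := (gH _ Kx, gH _ Ky).
by rewrite -[in LHS](fg x) // -[in LHS](fg y) // -fM // gf //; apply: HM.
Qed.

Lemma alg_iso_trans N N' N'' (H : set 'M[k]_N) (K : set 'M[k]_N')
    (L : set 'M[k]_N'') :
  is_subgroup H -> is_subgroup K -> is_subgroup L ->
  alg_iso H K -> alg_iso K L -> alg_iso H L.
Proof.
move=> Hg Kg Lg HK KL; have KH := alg_iso_sym Hg HK.
have LK := alg_iso_sym Kg KL.
case: HK => f [g [[fR gR] fK gH fM [gf fg]]].
case: KL => f' [g' [[f'R g'R] f'L g'K f'M [g'f' f'g']]].
have gM x y : K x -> K y -> g (x *m y) = g x *m g y.
  move=> Kx Ky; have [_ _ HM _] := Hg.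
  have [Hx Hy] := (gH _ Kx, gH _ Ky).
  by rewrite -[in LHS](fg x) // -[in LHS](fg y) // -fM // gf //; apply: HM.
have g'M x y : L x -> L y -> g' (x *m y) = g' x *m g' y.
  move=> Kx Ky; have [_ _ HM _] := Kg.
  have [Hx Hy] := (g'K _ Kx, g'K _ Ky).
  by rewrite -[in LHS](f'g' x) // -[in LHS](f'g' y) // -f'M // g'f' //; apply: HM.
exists (fun x => f' (f x)), (fun x => g (g' x)); split.
- split=> i j; first exact: (regular_on_comp (h := fun x => f' x i j) Hg Kg).
  exact: (regular_on_comp (h := fun x => g x i j) Lg Kg).
- by move=> x /fK /f'L.
- by move=> x /g'K /gH.
- by move=> x y Hx Hy; rewrite fM // f'M //; apply: fK.
- split=> x xin; first by rewrite g'f' ?gf //; apply: fK.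
  by rewrite fg ?f'g' //; apply: g'K.
Qed.

End RegularMaps.

(** * Matrices supported on a preorder *)

Section SupportedMatrices.
Variables (k : fieldType) (n : nat).
Implicit Types (g h : 'M[k]_n) (le : rel 'I_n).

Definition mx_supported le g : Prop := forall i j, g i j != 0 -> le i j.

Lemma mx_supported0 le g i j : mx_supported le g -> ~~ le i j -> g i j = 0.
Proof. by move=> gs; apply: contraNeq; apply: gs. Qed.

Lemma mx_supported1 le : reflexive le -> mx_supported le 1%:M.
Proof.
by move=> lexx i j; rewrite mxE; have [->|_] := eqVneq i j; rewrite ?lexx ?eqxx.
Qed.

Lemma mx_supportedM le g h : transitive le ->
  mx_supported le g -> mx_supported le h -> mx_supported le (g *m h).
Proof.
move=> letr gs hs i j; rewrite mxE; apply: contraNT => lij.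
rewrite big1 // => l _; apply/eqP; rewrite mulf_eq0.
apply: contraNT lij; rewrite negb_or => /andP[gil hlj].
exact: letr (gs _ _ gil) (hs _ _ hlj).
Qed.

(** The matrix g maps the span of the x_i with le i j into itself, hence onto
    itself by dimension; so its inverse does the same. *)
Lemma mx_supportedV le g : reflexive le -> transitive le ->
  g \in unitmx -> mx_supported le g -> mx_supported le (invmx g).
Proof.
move=> lexx letr gu gs i j; apply: contraNT => lij.
pose P : 'M[k]_n := diag_mx (\row_l (le l j)%:R).
have PE (A : 'M[k]_n) : (P *m A <= P)%MS -> forall l i', le l j -> A l i' != 0 -> le i' j.
  case/submxP => C CE l i' lj; apply: contraNT => li'.
  have := congr1 (fun X : 'M_n => X l i') CE.
  rewrite mul_diag_mx mul_mx_diag !mxE lj (negPf li') mul1r mulr0.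
  by move=> ->.
have PgP : (P *m g^T <= P)%MS.
  apply/submxP; exists (P *m g^T); apply/matrixP => l i'.
  rewrite mul_mx_diag mul_diag_mx !mxE.
  case: (boolP (le i' j)) => li'; first by rewrite mulr1.
  rewrite mulr0; case: (boolP (le l j)) => lj; last by rewrite mul0r.
  rewrite mul1r; apply: mx_supported0 gs _; apply: contra li' => /letr; exact.
have /submxP [C CE] : (P <= P *m g^T)%MS.
  rewrite -(geq_leqif (mxrank_leqif_sup PgP)) mxrankMfree //.
  by rewrite row_free_unit unitmx_tr.
have PV : (P *m (invmx g)^T <= P)%MS.
  apply/submxP; exists C.
  by rewrite {1}CE trmx_inv -!mulmxA mulmxV ?mulmx1 // unitmx_tr.
apply/eqP; apply: contraNeq lij => gij.
by apply: (PE _ PV j) => //; rewrite mxE.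
Qed.

Definition supported_units (le : rel 'I_n) : set 'M[k]_n :=
  [set g | g \in unitmx /\ mx_supported le g].

Lemma supported_units_subgroup le : reflexive le -> transitive le ->
  is_subgroup (supported_units le).
Proof.
move=> rfl tr; split.
- by move=> g [].
- by split; [apply: unitmx1 | apply: mx_supported1].
- by move=> g h [gu gs] [hu hs]; split; [rewrite unitmx_mul gu | apply: mx_supportedM].
- by move=> g [gu gs]; split; [rewrite unitmx_inv | apply: mx_supportedV].
Qed.

(** Some term of the Leibniz formula for the determinant is nonzero, and its
    permutation sends S into T. *)
Lemma unitmx_col_count g (S T : {set 'I_n}) : g \in unitmx ->
  (forall i j, j \in S -> g i j != 0 -> i \in T) -> (#|S| <= #|T|)%N.
Proof.
rewrite unitmxE unitfE => gdet ST.
have [s sP] : exists s : 'S_n, \prod_i g i (s i) != 0.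
  apply/existsP; apply: contraNT gdet; rewrite negb_exists => /forallP nz.
  rewrite /determinant big1 // => s _.
  by have := nz s; rewrite negbK => /eqP ->; rewrite mulr0.
rewrite -(card_imset S (@perm_inj _ s^-1)); apply: subset_leq_card.
apply/fintype.subsetP => _ /imsetP[j Sj ->]; apply: ST Sj _.
by move/prodf_neq0: sP => /(_ (s^-1 j)%g isT); rewrite permKV.
Qed.

Section Generation.
Variables (le : rel 'I_n) (P : 'M[k]_n -> Prop).
Hypotheses (lexx : reflexive le) (letr : transitive le).
Hypothesis PM : forall g h, P g -> P h -> P (g *m h).
Hypothesis Pdiag : forall t : 'rV_n, (forall i, t 0 i != 0) -> P (diag_mx t).
Hypothesis Ptransvection : forall i j (c : k), le i j -> i != j ->
  P (1%:M + c *: delta_mx i j).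

(** This is the product of the transvections 1 + c_l E_lj, all cross terms E_lj
    E_l'j being zero since c_j = 0. *)
Lemma column_transvection_gen j (c : 'I_n -> k) : c j = 0 ->
  (forall l, c l != 0 -> le l j) -> P (1%:M + \sum_l c l *: delta_mx l j).
Proof.
move=> cj cle; elim: (index_enum _) => [|l s IHs].
  rewrite big_nil addr0 -diag_const_mx; apply: Pdiag => i.
  by rewrite mxE oner_neq0.
rewrite big_cons; have [cl|cl] := eqVneq (c l) 0.
  by rewrite cl scale0r add0r.
have lj : l != j by apply: contraNneq cl => ->; rewrite cj.
have E0 : (c l *: delta_mx l j) *m (\sum_(i <- s) c i *: delta_mx i j) = 0 :> 'M_n.
  rewrite mulmx_sumr big1 // => i _; rewrite -scalemxAl -scalemxAr.
  rewrite mul_delta_mx_cond; have [<-|] := eqVneq j i.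
    by rewrite cj scale0r scaler0.
  by rewrite mulr0n !scaler0.
have -> : 1%:M + (c l *: delta_mx l j + \sum_(i <- s) c i *: delta_mx i j) =
    (1%:M + c l *: delta_mx l j) *m (1%:M + \sum_(i <- s) c i *: delta_mx i j).
  by rewrite mulmxDr mulmx1 mulmxDl mul1mx E0 addr0 addrA.
by apply: PM => //; apply: Ptransvection => //; apply: cle.
Qed.

Lemma transvection_mulE i l (c : k) g a s :
  ((1%:M + c *: delta_mx i l) *m g) a s = g a s + c * (a == i)%:R * g l s.
Proof.
rewrite mulmxDl mul1mx mxE -scalemxAl mxE; congr (_ + _); rewrite -mulrA; congr (_ * _).
rewrite mxE (bigD1 l) //= big1 => [|l' l'l]; last first.
  by rewrite mxE (negPf l'l) andbF mul0r.
by rewrite mxE eqxx andbT addr0.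
Qed.

Lemma transvection_inv i l (c : k) : i != l ->
  (1%:M + c *: delta_mx i l) *m (1%:M - c *: delta_mx i l) = 1%:M :> 'M_n.
Proof.
move=> il; rewrite mulmxBr mulmx1 mulmxDl mul1mx -scalemxAl -scalemxAr.
by rewrite mul_delta_mx_0 1?eq_sym // !scaler0 addr0 addrK.
Qed.

(** Gaussian elimination within the preorder. The columns are made diagonal one
    at a time by row operations, and S is the set of the columns already
    treated. A row operation for column j uses only rows l with le l j, or a
    row l with le j l to make the pivot nonzero. *)
Lemma supported_unit_gen g : g \in unitmx -> mx_supported le g -> P g.
Proof.
move=> gu gs.
suff: forall m (S : {set 'I_n}) g, g \in unitmx -> mx_supported le g ->
    (forall i j, j \in S -> i != j -> g i j = 0) -> (#|~: S| <= m)%N -> P g.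
  by move=> /(_ _ (@finset.set0 _) g gu gs); apply; [move=> i j; rewrite inE|].
elim=> [|m IHm] S {gu gs}g gu gs gS.
  rewrite leqn0 cards_eq0 => /eqP S0.
  have gd : g = diag_mx (\row_i g i i).
    apply/matrixP => i j; rewrite !mxE; have [->|ij] := eqVneq i j.
      by rewrite mulr1n.
    by rewrite mulr0n gS // -[S]finset.setCK S0 finset.in_setC finset.in_set0.
  rewrite gd; apply: Pdiag => i; rewrite mxE.
  move: gu; rewrite {1}gd unitmxE unitfE det_diag => /prodf_neq0 /(_ i isT).
  by rewrite mxE.
case: (set_0Vmem (~: S)) => [S0|[j]].
  by move=> _; apply: (IHm S) => //; rewrite S0 cards0.
rewrite inE => jS Scard.
have Vs := mx_supportedV lexx letr gu gs.
have cleared a l : l \in S -> (a == l)%:R = invmx g a l * g l l.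
  move=> lS; have : (invmx g *m g) a l = (a == l)%:R by rewrite mulVmx // mxE.
  rewrite mxE (bigD1 l) //= big1 ?addr0 // => i il.
  by rewrite (gS i l) ?mulr0.
(* The pivot: row j of g^-1 vanishes on S, so it meets column j of g off S. *)
have [l [lS jl glj]] : exists l, [/\ l \notin S, le j l & g l j != 0].
  have : (invmx g *m g) j j != 0 by rewrite mulVmx // mxE eqxx oner_neq0.
  rewrite mxE => nz.
  have [l] : exists l, invmx g j l * g l j != 0.
    apply/existsP; apply: contraNT nz; rewrite negb_exists => /forallP nz.
    by rewrite big1 // => l _; apply/eqP; have := nz l; rewrite negbK.
  rewrite mulf_eq0 negb_or => /andP[hjl glj]; exists l; split=> //; last exact: Vs.
  apply: contraNN hjl => lS.
  have gll : g l l != 0.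
    have := oner_neq0 k; rewrite -[1]/(true%:R) -(eqxx l) (cleared l l lS).
    by rewrite mulf_eq0 negb_or => /andP[].
  rewrite -(mulIr_eq0 _ (mulIf gll)) -cleared //.
  by have [jl|] := eqVneq j l => //; rewrite jl lS in jS.
wlog gjj : g gu gs gS Vs cleared glj / g j j != 0.
  move=> H; have [gjj|gjj] := eqVneq (g j j) 0; last exact: (H g).
  have jl' : j != l by apply: contraNneq glj => <-; rewrite gjj.
  have tr0 c := @transvection_inv j l c jl'.
  have trs c : mx_supported le (1%:M + c *: delta_mx j l).
    move=> a b; rewrite !mxE; have [->|_] := eqVneq a b; first by rewrite lexx.
    by rewrite add0r; case: andP => [[/eqP -> /eqP ->] //|_]; rewrite mulr0 eqxx.
  have -> : g = (1%:M + (-1) *: delta_mx j l) *m ((1%:M + 1 *: delta_mx j l) *m g).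
    by have := tr0 (-1); rewrite mulmxA !scaleN1r opprK scale1r => ->; rewrite mul1mx.
  apply: PM; first exact: Ptransvection.
  set g1 := (X in P X).
  have g1u : g1 \in unitmx.
    by rewrite unitmx_mul gu andbT; case: (mulmx1_unit (tr0 1)).
  have g1s : mx_supported le g1 by apply: mx_supportedM.
  have g1S a b : b \in S -> a != b -> g1 a b = 0.
    move=> bS ab; rewrite transvection_mulE (gS a b) // (gS l b) ?mulr0 ?addr0 //.
    by apply: contraNneq lS => ->.
  apply: H => //; first exact: mx_supportedV.
  - move=> a b bS.
    have : (invmx g1 *m g1) a b = (a == b)%:R by rewrite mulVmx // mxE.
    rewrite mxE (bigD1 b) //= big1 ?addr0 // => i il.
    by rewrite (g1S i b) ?mulr0.
  - by rewrite transvection_mulE [l == j]eq_sym (negPf jl') mulr0 mul0r addr0.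
  - by rewrite transvection_mulE eqxx gjj add0r !mul1r.
pose c a := if a == j then 0 else g a j / g j j.
have cj : c j = 0 by rewrite /c eqxx.
have cle a : c a != 0 -> le a j.
  rewrite /c; case: ifP => [_|_]; first by rewrite eqxx.
  by rewrite mulf_eq0 negb_or => /andP[/gs].
pose C (d : k) := 1%:M + \sum_a (d * c a) *: delta_mx a j : 'M[k]_n.
have CE d (h : 'M_n) a b : (C d *m h) a b = h a b + d * c a * h j b.
  rewrite mulmxDl mul1mx mxE; congr (_ + _); rewrite mxE (bigD1 j) //=.
  rewrite [X in _ + X]big1 => [|e ej]; last first.
    rewrite summxE big1 ?mul0r // => i _.
    by rewrite !mxE (negPf ej) andbF mulr0.
  rewrite addr0 summxE (bigD1 a) //= big1 => [|i ia]; last first.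
    by rewrite !mxE eq_sym (negPf ia) mulr0.
  by rewrite addr0 !mxE !eqxx mulr1.
have CK : C 1 *m C (-1) = 1%:M.
  apply/matrixP => a b; rewrite CE.
  have CEj x y : C (-1) x y = (x == y)%:R - c x * (j == y)%:R.
    by rewrite -[C _]mulmx1 CE !mxE mulN1r mulNr.
  by rewrite !CEj cj mul0r subr0 mul1r subrK mxE.
have Cs d : mx_supported le (C d).
  move=> a b; rewrite -[C d]mulmx1 CE !mxE.
  have [->|ab] := eqVneq a b; first by rewrite lexx.
  rewrite add0r; have [<-|jb] := eqVneq j b; last by rewrite mulr0 eqxx.
  by rewrite mulr1 mulf_eq0 negb_or => /andP[_ /cle].
have -> : g = C 1 *m (C (-1) *m g) by rewrite mulmxA CK mul1mx.
apply: PM.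
  apply: (@column_transvection_gen _ (fun a => 1 * c a)).
    by rewrite cj mulr0.
  by move=> a; rewrite mul1r; apply: cle.
apply: (IHm (j |: S)).
- by rewrite unitmx_mul gu andbT; case: (mulmx1_unit CK).
- exact: mx_supportedM.
- move=> a b; rewrite CE mulN1r finset.in_setU1 => /orP[/eqP ->|bS] ab.
    by rewrite /c (negPf ab) mulNr divfK // subrr.
  rewrite (gS a b) // (gS j b) ?mulr0 ?addr0 //.
  by apply: contraNneq jS => ->.
- by rewrite -ltnS (leq_trans _ Scard) // proper_card // properE finset.setCS finset.subsetUr
    /= finset.setCS finset.subUset finset.sub1set (negPf jS).
Qed.

End Generation.
End SupportedMatrices.

(** * Unipotent matrices and block diagonal parts *)

Section UnipotentMatrices.
Variable k : closedFieldType.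

(** Over an algebraically closed field the characteristic polynomial splits,
    and all its roots are 0. *)
Lemma mxtrace_nilpotent n (x : 'M[k]_n) l : x ^+ l = 0 -> \tr x = 0.
Proof.
case: n x => [|n] x xl; first by rewrite /mxtrace big_ord0.
have eig z : root (char_poly x) z -> z = 0.
  rewrite -eigenvalue_root_char => /eigenvalueP[v vx v0].
  have vxl : v *m x ^+ l = z ^+ l *: v.
    elim: (l) => [|l' IHl]; first by rewrite !expr0 mulmx1 scale1r.
    by rewrite exprSr mulmxA IHl -scalemxAl vx scalerA -exprSr.
  move: vxl; rewrite xl mulmx0 => /esym /eqP.
  by rewrite scaler_eq0 (negPf v0) orbF expf_eq0 => /andP[_ /eqP].
have [rs cE] := closed_field_poly_normal (char_poly x).
move/monicP: (char_poly_monic x) cE => -> ; rewrite scale1r => cE.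
have rs0 : all (pred1 0) rs.
  by apply/allP => z zrs; apply/eqP/eig; rewrite cE root_prod_XsubC.
have cX : char_poly x = 'X^(size rs).
  rewrite {1}cE (eq_big_seq (fun=> 'X)) => [|z /(allP rs0) /eqP ->]; last first.
    by rewrite subr0.
  by rewrite big_const_seq count_predT iter_mulr_1.
have rsn : size rs = n.+1.
  by have := size_char_poly x; rewrite cX size_polyXn => -[].
have := char_poly_trace x (ltn0Sn n).
rewrite cX rsn coefXn /= (ltn_eqF (ltnSn n)) => /eqP.
by rewrite eq_sym oppr_eq0 => /eqP.
Qed.

Lemma mxtrace_unipotent n (x : 'M[k]_n) l :
  (x - 1%:M) ^+ l = 0 -> \tr x = n%:R.
Proof.
by move=> /mxtrace_nilpotent /eqP; rewrite raddfB /= mxtrace1 subr_eq0 => /eqP.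
Qed.

(** All elements of V have trace n. For x in V and E = E_ij, the element x
    (1+E) x (1-E) of V has trace tr(x^2) - (x_ji)^2, since tr(x E x) = tr(x x
    E). So x_ji = 0 within each block, and x is diagonal and unipotent. *)
Lemma normal_unipotent_block_diag n (b : 'I_n -> nat) (V : set 'M[k]_n) :
  (forall x, V x -> mx_supported (fun i j => b i == b j) x) ->
  (forall x y, V x -> V y -> V (x *m y)) ->
  (forall x i j, V x -> b i = b j -> i != j ->
     V ((1%:M + delta_mx i j) *m x *m (1%:M - delta_mx i j))) ->
  is_unipotent V -> V `<=` [set 1%:M].
Proof.
move=> Vb VM Vconj Vu x Vx /=.
have xd i j : i != j -> x i j = 0.
  move=> ij; have [bij|] := eqVneq (b i) (b j); last exact: (mx_supported0 (Vb x Vx)).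
  have tr1 y : V y -> \tr y = n%:R by move=> /Vu [l /mxtrace_unipotent].
  have ji : j != i by rewrite eq_sym.
  have := tr1 _ (VM _ _ Vx (Vconj _ _ _ Vx (esym bij) ji)).
  have := tr1 _ (VM _ _ Vx Vx).
  set E := delta_mx j i.
  have -> : x *m ((1%:M + E) *m x *m (1%:M - E)) =
      x *m x + (x *m E *m x - x *m (x *m E)) - x *m (E *m x *m E).
    rewrite mulmxDl mul1mx mulmxBr mulmx1 mulmxDl mulmxBr !mulmxDr.
    by rewrite opprD !addrA !mulmxA.
  rewrite raddfB raddfD raddfB /= [\tr (x *m E *m x)]mxtrace_mulC subrr addr0.
  have -> : \tr (x *m (E *m x *m E)) = x i j ^+ 2.
    have -> : E *m x *m E = x i j *: E.
      apply/matrixP => s t; rewrite !mxE (bigD1 j) //= big1 => [|u uj].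
        rewrite !mxE (bigD1 i) //= big1 => [|u ui]; last first.
          by rewrite !mxE (negPf ui) andbF mul0r.
        rewrite !mxE !eqxx !andbT addr0 addr0.
        by case: (s == j); case: (t == i); rewrite ?mul1r ?mulr1 ?mul0r ?mulr0.
      by rewrite [E u t]mxE (negPf uj) mulr0.
    rewrite -scalemxAr linearZ /=; rewrite expr2; congr (_ * _).
    rewrite /mxtrace (bigD1 i) //= big1 => [|u ui].
      rewrite mxE (bigD1 j) //= big1 => [|u uj].
        by rewrite mxE !eqxx mulr1 !addr0.
      by rewrite mxE (negPf uj) mulr0.
    rewrite mxE big1 // => t _.
    by rewrite mxE (negPf ui) andbF mulr0.
  move=> -> /eqP; rewrite subr_eq addrC -subr_eq subrr eq_sym expf_eq0.
  by move/eqP.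
have [l xl] := Vu x Vx.
have powE s i j : ((x - 1%:M) ^+ s) i j = (x i i - 1) ^+ s * (i == j)%:R.
  elim: s j => [|s IHs] j; first by rewrite !expr0 mxE mul1r.
  rewrite exprSr mxE (bigD1 i) //= big1 => [|t ti]; last first.
    by rewrite IHs eq_sym (negPf ti) mulr0 mul0r.
  rewrite addr0 IHs eqxx mulr1 exprSr !mxE -mulrA; congr (_ * _).
  have [<-|ij] := eqVneq i j; first by rewrite mulr1.
  by rewrite (xd i j ij) subrr mulr0.
apply/matrixP => i j; rewrite mxE; have [<-|/xd //] := eqVneq i j.
have := powE l i i; rewrite xl mxE eqxx mulr1 => /esym/eqP.
by rewrite expf_eq0 subr_eq0 => /andP[_ /eqP].
Qed.

End UnipotentMatrices.

Section BlockDiagonalPart.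
Variables (k : fieldType) (n : nat) (b : 'I_n -> nat) (le : rel 'I_n).
Implicit Types g h : 'M[k]_n.

Definition same_block : rel 'I_n := fun i j => b i == b j.

Lemma same_block_refl : reflexive same_block. Proof. by move=> i; apply: eqxx. Qed.
Lemma same_block_trans : transitive same_block.
Proof. by move=> j i l /eqP ij /eqP jl; rewrite /same_block ij jl. Qed.

Definition block_part g : 'M[k]_n :=
  \matrix_(i, j) if b i == b j then g i j else 0.

Lemma block_part_supported g : mx_supported same_block (block_part g).
Proof. by move=> i j; rewrite mxE /same_block; case: ifP => // _; rewrite eqxx. Qed.

Lemma block_part_id g :
  mx_supported same_block g -> block_part g = g.
Proof.
move=> gs; apply/matrixP => i j; rewrite mxE; case: ifP => // bij.
by rewrite (mx_supported0 gs) // /same_block bij.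
Qed.

Lemma block_part1 : block_part 1%:M = 1%:M.
Proof. exact/block_part_id/mx_supported1/same_block_refl. Qed.

Hypothesis le_b : forall i j, le i j -> (b i <= b j)%N.

(** In an entry of the product with both indices in one block, the middle index
    lies between them and so in the same block. *)
Lemma block_partM g h : mx_supported le g -> mx_supported le h ->
  block_part (g *m h) = block_part g *m block_part h.
Proof.
move=> gs hs; apply/matrixP => i j; rewrite !mxE; case: eqP => [bij|bij].
  apply: eq_bigr => l _; rewrite !mxE.
  have [bil|bil] := eqVneq (b i) (b l); first by rewrite -bil -bij eqxx.
  rewrite mul0r; have [->|gil] := eqVneq (g i l) 0; first by rewrite mul0r.
  have [->|hlj] := eqVneq (h l j) 0; first by rewrite mulr0.
  have := le_b (gs _ _ gil); have := le_b (hs _ _ hlj).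
  by rewrite -bij => *; move/eqP: bil; case; apply/anti_leq/andP.
rewrite big1 // => l _; rewrite !mxE.
case: eqP => [bil|]; last by rewrite mul0r.
by case: eqP => [blj|]; [case: bij; rewrite bil | rewrite mulr0].
Qed.

Lemma block_part_unit g : reflexive le -> transitive le -> mx_supported le g ->
  g \in unitmx -> block_part g \in unitmx.
Proof.
move=> lexx letr gs gu.
have : block_part g *m block_part (invmx g) = 1%:M.
  by rewrite -block_partM ?mulmxV ?block_part1 //; apply: mx_supportedV.
by case/mulmx1_unit.
Qed.

End BlockDiagonalPart.

(** * Substitutions and the ideal attached to a graph on the variables *)

Section Substitution.
Variables (k : fieldType) (n : nat).
Implicit Types (p q : {mpoly k[n]}) (y z : 'I_n -> {mpoly k[n]}).

Definition subst y p : {mpoly k[n]} := p \mPo [tuple y i | i < n].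

HB.instance Definition _ y := GRing.RMorphism.copy (subst y) (comp_mpoly [tuple y i | i < n]).

Lemma substX y i : subst y 'X_i = y i.
Proof. by rewrite /subst comp_mpolyXU -tnth_nth tnth_mktuple. Qed.

Lemma substC y c : subst y c%:MP = c%:MP.
Proof. exact: comp_mpolyC. Qed.

Lemma substZ y c p : subst y (c *: p) = c *: subst y p.
Proof. exact: comp_mpolyZ. Qed.

Lemma subst_id p : subst (fun i => 'X_i) p = p.
Proof. exact: comp_mpoly_id. Qed.

(** Polynomials are the free commutative algebra on the variables. *)
Lemma mpoly_rmorph_ext (S : pzRingType) (f g : {rmorphism {mpoly k[n]} -> S}) :
  (forall c, f c%:MP = g c%:MP) -> (forall i, f 'X_i = g 'X_i) -> f =1 g.
Proof.
move=> fgC fgX; elim/mpolyind => [|c m p _ _ IHp]; first by rewrite !rmorph0.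
rewrite !rmorphD IHp /= -mul_mpolyC !rmorphM /= fgC; congr (_ * _ + _).
rewrite mpolyXE_id !rmorph_prod /=; apply: eq_bigr => i _.
by rewrite !rmorphXn /= fgX.
Qed.

Lemma subst_comp y z p : subst y (subst z p) = subst (fun j => subst y (z j)) p.
Proof.
pose f : {rmorphism _ -> _} := subst y \o subst z.
pose g : {rmorphism _ -> _} := subst (fun j => subst y (z j)).
apply: (@mpoly_rmorph_ext _ f g) => [c|i] /=; first by rewrite !substC.
by rewrite !substX.
Qed.

Lemma subst_mnm y (m : 'X_{1..n}) : subst y 'X_[m] = \prod_i y i ^+ m i.
Proof. by rewrite /subst comp_mpolyX; apply: eq_bigr => i _; rewrite tnth_mktuple. Qed.

End Substitution.

Section MonomialWeights.
Variables (k : fieldType) (n : nat) (w : 'X_{1..n} -> nat).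
Hypothesis wD : forall m m', w (m + m')%MM = (w m + w m')%N.
Implicit Types p q : {mpoly k[n]}.

(** The two weights that matter are the degree and, in the proof that the
    radical is unipotent, a weight depending on the block of each variable. *)
Definition weight_ge c p : Prop := forall m, p@_m != 0 -> (c <= w m)%N.

Lemma weight_ge0 p : weight_ge 0 p. Proof. by []. Qed.

Lemma weight_ge_trans c d p : (d <= c)%N -> weight_ge c p -> weight_ge d p.
Proof. by move=> dc pc m /pc; apply: leq_trans. Qed.

Lemma weight_ge_zero c : weight_ge c 0.
Proof. by move=> m; rewrite mcoeff0 eqxx. Qed.

Lemma weight_geD c p q : weight_ge c p -> weight_ge c q -> weight_ge c (p + q).
Proof.
move=> pc qc m; rewrite mcoeffD; have [->|/pc //] := eqVneq p@_m 0.
by rewrite add0r => /qc.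
Qed.

Lemma weight_geZ c a p : weight_ge c p -> weight_ge c (a *: p).
Proof. by move=> pc m; rewrite mcoeffZ mulf_eq0 negb_or => /andP[_ /pc]. Qed.

Lemma weight_ge_sum c I (s : seq I) (P : pred I) (F : I -> {mpoly k[n]}) :
  (forall i, P i -> weight_ge c (F i)) -> weight_ge c (\sum_(i <- s | P i) F i).
Proof.
move=> Fc; elim/big_ind: _ => //; first exact: weight_ge_zero.
by move=> p q; apply: weight_geD.
Qed.

Lemma weight_geX c m : (c <= w m)%N -> weight_ge c 'X_[m].
Proof. by move=> cm m'; rewrite mcoeffX; have [<-|] := eqVneq m m'; rewrite ?eqxx. Qed.

Lemma weight_geM c d p q : weight_ge c p -> weight_ge d q -> weight_ge (c + d) (p * q).
Proof.
move=> pc qd m; rewrite -mcoeff_msupp => /msuppM_le /allpairsP[[m1 m2] /=].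
rewrite !mcoeff_msupp => -[/pc c1 /qd d2 ->].
by rewrite wD leq_add.
Qed.

Lemma weight_geXn c p s : weight_ge c p -> weight_ge (c * s) (p ^+ s).
Proof.
move=> pc; elim: s => [|s IHs]; first by rewrite muln0.
by rewrite exprS mulnS; apply: weight_geM.
Qed.

Lemma weight_ge_prod I (s : seq I) (c : I -> nat) (F : I -> {mpoly k[n]}) :
  (forall i, weight_ge (c i) (F i)) ->
  weight_ge (\sum_(i <- s) c i) (\prod_(i <- s) F i).
Proof.
move=> Fc; elim: s => [|i s IHs]; first by rewrite !big_nil.
by rewrite !big_cons; apply: weight_geM.
Qed.

End MonomialWeights.

Lemma leq_mdeg n (m m' : 'X_{1..n}) : (m <= m')%MM -> (mdeg m <= mdeg m')%N.
Proof. by move=> /mnm_lepP mm'; rewrite !mdegE; apply: leq_sum. Qed.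

Lemma mnm1D_inj n (i j a b : 'I_n) : (U_(i) + U_(j) = U_(a) + U_(b))%MM ->
  (i = a /\ j = b) \/ (i = b /\ j = a).
Proof.
move=> E.
have [ia|ia] := eqVneq i a.
  by move: E; rewrite ia => /addmI /eqP; rewrite eq_mnm1 => /eqP ->; left.
have ib : i = b.
  have := congr1 (fun m : 'X_{1..n} => m i) E; rewrite /= !mnmDE !mnm1E eqxx.
  by rewrite [a == i]eq_sym (negPf ia) /=; have [->|] := eqVneq b i.
by move: E; rewrite ib addmC => /addIm /eqP; rewrite eq_mnm1 => /eqP ->; right.
Qed.

Section EdgeIdeal.
Variables (k : fieldType) (n : nat) (e : rel 'I_n).
Implicit Types (p q : {mpoly k[n]}) (y z : 'I_n -> {mpoly k[n]}) (m : 'X_{1..n}).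

(** Divisibility by a relation, rather than equality with one, makes the
    complement visibly stable under multiplication. *)
Definition standard_mnm m : bool :=
  (mdeg m < 3)%N && [forall i, forall j, e i j ==> ~~ (U_(i) + U_(j) <= m)%MM].

Lemma standard_mnm0 : standard_mnm 0%MM.
Proof.
rewrite /standard_mnm mdeg0 /=; apply/'forall_forallP => i j; apply/implyP => _.
by apply/negP => /leq_mdeg; rewrite mdegD !mdeg1 mdeg0.
Qed.

Lemma standard_mnm1 i : standard_mnm U_(i).
Proof.
rewrite /standard_mnm mdeg1 /=; apply/'forall_forallP => a b; apply/implyP => _.
by apply/negP => /leq_mdeg; rewrite mdegD !mdeg1.
Qed.

Lemma standard_mnm_le m m' : (m <= m')%MM -> standard_mnm m' -> standard_mnm m.
Proof.
move=> /mnm_lepP mm' /andP[deg3 /'forall_forallP ne]; apply/andP; split.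
  by apply: leq_ltn_trans deg3; apply: leq_mdeg; apply/mnm_lepP.
apply/'forall_forallP => i j; apply/implyP => eij.
have := ne i j; rewrite eij /=; apply: contra => /mnm_lepP le2.
by apply/mnm_lepP => s; apply: leq_trans (mm' s).
Qed.

(** A monomial of degree 2 is divisible by no other monomial of degree 2. *)
Lemma standard_mnm2 i j : ssrbool.symmetric e ->
  standard_mnm (U_(i) + U_(j))%MM = ~~ e i j.
Proof.
move=> esym; apply/idP/idP.
  move=> /andP[_ /'forall_forallP /(_ i j)]; apply: contraTN => -> /=.
  by rewrite negbK; apply/mnm_lepP.
move=> neij; apply/andP; split; first by rewrite mdegD !mdeg1.
apply/'forall_forallP => a b; apply/implyP => eab.
apply: contra neij => /mnm_lepP leE.
have /mnm1D_inj[[-> ->]|[-> ->]] //: (U_(i) + U_(j) = U_(a) + U_(b))%MM.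
  have le0 s : (0 <= (U_(i) + U_(j))%MM s - (U_(a) + U_(b))%MM s)%N by [].
  have : mdeg (U_(i) + U_(j) - (U_(a) + U_(b)))%MM == 0%N.
    have : mdeg ((U_(i) + U_(j) - (U_(a) + U_(b))) + (U_(a) + U_(b)))%MM =
      mdeg (U_(i) + U_(j))%MM.
      by congr mdeg; apply/mnmP => s; rewrite mnmDE mnmBE subnK.
    by rewrite !mdegD !mdeg1 => /eqP; rewrite -[X in _ == X]add0n eqn_add2r.
  rewrite mdeg_eq0 => /eqP m0; apply/mnmP => s; apply/eqP; rewrite eqn_leq leE andbT.
  by have := congr1 (fun m : 'X_{1..n} => m s) m0; rewrite mnmBE mnm0E => /eqP.
by rewrite esym.
Qed.

Definition edge_ideal_pred : pred {mpoly k[n]} :=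
  fun p => all (fun m => ~~ standard_mnm m) (msupp p).

Lemma edge_ideal_predP p :
  reflect (forall m, standard_mnm m -> p@_m = 0) (p \in edge_ideal_pred).
Proof.
apply: (iffP allP) => [pI m sm|pI m].
  by apply: contraTeq sm; rewrite -mcoeff_msupp => /pI.
by rewrite mcoeff_msupp; apply: contraNN => /pI ->.
Qed.

Lemma edge_idealr_closed : idealr_closed edge_ideal_pred.
Proof.
split.
- by apply/edge_ideal_predP => m _; rewrite mcoeff0.
- apply/edge_ideal_predP => /(_ _ standard_mnm0) /eqP.
  by rewrite mcoeff1 eqxx oner_eq0.
move=> a u v /edge_ideal_predP uI /edge_ideal_predP vI.
apply/edge_ideal_predP => m sm; rewrite mcoeffD vI // addr0.
rewrite mcoeffM big1 // => -[m1 m2] /= /eqP mE; rewrite uI ?mulr0 //.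
by apply: standard_mnm_le sm; rewrite [X in (_ <= X)%MM]mE lem_addl.
Qed.

HB.instance Definition _ :=
  isIdealr.Build {mpoly k[n]} edge_ideal_pred edge_idealr_closed.

Definition edge_ideal : idealr {mpoly k[n]} := edge_ideal_pred.

Lemma edge_idealP p :
  reflect (forall m, standard_mnm m -> p@_m = 0) (p \in edge_ideal).
Proof. exact: edge_ideal_predP. Qed.

Lemma edge_idealX m : ('X_[m] \in edge_ideal) = ~~ standard_mnm m.
Proof.
apply/edge_idealP/idP => [XI|sm m' sm'].
  by apply/negP => /XI /eqP; rewrite mcoeffX eqxx oner_eq0.
rewrite mcoeffX; have [mm'|//] := eqVneq m m'.
by rewrite mm' sm' in sm.
Qed.

Lemma edge_idealXX i j : ssrbool.symmetric e -> ('X_i * 'X_j \in edge_ideal) = e i j.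
Proof. by move=> esym; rewrite -mpolyXD edge_idealX standard_mnm2 // negbK. Qed.

Lemma mdeg_ge3_edge_ideal p : weight_ge (@mdeg n) 3 p -> p \in edge_ideal.
Proof.
move=> p3; apply/edge_idealP => m /andP[m3 _].
by apply: contraTeq m3 => /p3; rewrite -leqNgt.
Qed.

Lemma edge_ideal_monomial : monomial_ideal edge_ideal.
Proof.
exists [set m | ~~ standard_mnm m] => p; split=> [pI|[s sS ->]].
  exists [seq ((p@_m)%:MP, m) | m <- msupp p].
    by move=> _ /mapP[m mp ->] /=; apply: (allP pI).
  by rewrite big_map [LHS]mpolyE; apply: eq_bigr => m _; rewrite mul_mpolyC.
rewrite big_seq; apply: rpred_sum => c cs; apply: idealMr.
by rewrite edge_idealX; apply: (sS c).
Qed.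

Lemma edge_ideal_cofinite : cofinite_support edge_ideal.
Proof.
exists [seq (b : 'X_{1..n}) | b : 'X_{1..n < 3} <- enum {: 'X_{1..n < 3}}] => m.
rewrite edge_idealX negbK => /andP[m3 _].
by apply/mapP; exists (BMultinom m3) => //; rewrite mem_enum.
Qed.

Lemma edge_ideal_var i : 'X_i \notin edge_ideal.
Proof. by rewrite edge_idealX negbK standard_mnm1. Qed.

(** The substitution descends to an endomorphism of A. *)
Definition preserves y : Prop := forall p, p \in edge_ideal -> subst y p \in edge_ideal.

(** The generators of degree at least 3 go to polynomials without terms of
    degree below 3; the other generators are the x_i x_j. *)
Lemma subst_edge_ideal y :
  (forall i, (y i)@_0%MM = 0) ->
  (forall i j, e i j -> y i * y j \in edge_ideal) -> preserves y.
Proof.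
move=> y0 ye p pI; rewrite [p]mpolyE raddf_sum /= big_seq.
apply: rpred_sum => m mp; rewrite substZ -mul_mpolyC; apply: idealMr.
have y1 i : weight_ge (@mdeg n) 1 (y i).
  move=> m'; rewrite lt0n mdeg_eq0; apply: contraNN => /eqP ->.
  by rewrite y0.
have: ~~ standard_mnm m by apply: (allP pI).
rewrite negb_and -leqNgt => /orP[m3|].
  apply: mdeg_ge3_edge_ideal; apply: weight_ge_trans m3 _.
  rewrite subst_mnm mdegE; apply: (weight_ge_prod (@mdegD n)) => i.
  by have := weight_geXn (@mdegD n) (s := m i) (y1 i); rewrite mul1n.
rewrite negb_forall => /existsP[i]; rewrite negb_forall => /existsP[j].
rewrite negb_imply negbK => /andP[eij /mnm_lepP ijm].
rewrite (_ : m = (m - (U_(i) + U_(j))) + (U_(i) + U_(j)))%MM; last first.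
  by apply/mnmP => s; rewrite mnmDE mnmBE subnK.
rewrite !mpolyXD !rmorphM /= !substX; apply: idealMr.
exact: ye.
Qed.

End EdgeIdeal.

(** * The quotient algebra and the matrices of its automorphisms *)

Section QuotientAlgebra.
Variables (k : fieldType) (n : nat) (e : rel 'I_n).
Local Notation I := (edge_ideal k e).
Local Notation A := {ideal_quot I}.
Implicit Types (p q : {mpoly k[n]}) (y z u : 'I_n -> {mpoly k[n]}) (m : 'X_{1..n}).

Lemma pi_eqP p q : \pi_A p = \pi_A q <-> p - q \in I.
Proof. by rewrite Quotient.idealrBE; split=> /eqP. Qed.

Lemma pi_eq0 p : \pi_A p = 0 <-> p \in I.
Proof. by rewrite -[0](rmorph0 (\pi_A)) pi_eqP subr0. Qed.

Lemma pi_coeffP p q :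
  \pi_A p = \pi_A q <-> forall m, standard_mnm e m -> p@_m = q@_m.
Proof.
rewrite pi_eqP; split=> [/edge_idealP pq m sm|pq].
  by apply/eqP; rewrite -subr_eq0 -mcoeffB pq.
by apply/edge_idealP => m sm; rewrite mcoeffB pq ?subrr.
Qed.

Lemma pi_surj (a : A) : exists p, a = \pi_A p.
Proof. by exists (repr a); rewrite reprK. Qed.

Lemma pi_scale c p : \pi_A (c *: p) = \pi_A c%:MP * \pi_A p.
Proof. by rewrite -mul_mpolyC rmorphM. Qed.

Definition induced y (a : A) : A := \pi_A (subst y (repr a)).

Lemma induced_pi y p : preserves e y -> induced y (\pi_A p) = \pi_A (subst y p).
Proof.
move=> yI; apply/pi_eqP; rewrite -rmorphB; apply: yI.
by apply/pi_eqP; rewrite reprK.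
Qed.

Lemma induced_rmorphism y : preserves e y ->
  exists f : {rmorphism A -> A}, forall p, f (\pi_A p) = \pi_A (subst y p).
Proof.
move=> yI.
have ib : zmod_morphism (induced y).
  move=> a b; have [[p ->] [q ->]] := (pi_surj a, pi_surj b).
  by rewrite -rmorphB !induced_pi // !rmorphB.
have im : monoid_morphism (induced y).
  split; first by rewrite -[1](rmorph1 (\pi_A)) induced_pi // !rmorph1.
  move=> a b; have [[p ->] [q ->]] := (pi_surj a, pi_surj b).
  by rewrite -rmorphM !induced_pi // !rmorphM.
pose f0 := GRing.isZmodMorphism.Build A A (induced y) ib.
pose f1 := GRing.isMonoidMorphism.Build A A (induced y) im.
pose f : {rmorphism A -> A} := HB.pack (induced y) f0 f1.
by exists f => p; apply: induced_pi.
Qed.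

(** Both sides are ring morphisms on polynomials that agree on constants and on
    variables. *)
Lemma rmorphism_subst (f : {rmorphism A -> A}) y :
  (forall c, f (\pi_A c%:MP) = \pi_A c%:MP) ->
  (forall i, f (\pi_A 'X_i) = \pi_A (y i)) ->
  forall p, f (\pi_A p) = \pi_A (subst y p).
Proof.
move=> fC fX.
pose g : {rmorphism _ -> _} := f \o \pi_A.
pose h : {rmorphism _ -> _} := \pi_A \o subst y.
apply: (@mpoly_rmorph_ext _ _ _ g h) => [c|i] /=; first by rewrite fC substC.
by rewrite fX substX.
Qed.

Lemma pi_subst_ext y z p : (forall i, \pi_A (y i) = \pi_A (z i)) ->
  \pi_A (subst y p) = \pi_A (subst z p).
Proof.
move=> yz.
pose g : {rmorphism _ -> _} := \pi_A \o subst y.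
pose h : {rmorphism _ -> _} := \pi_A \o subst z.
apply: (@mpoly_rmorph_ext _ _ _ g h) => [c|i] /=; first by rewrite !substC.
by rewrite !substX.
Qed.

Lemma preserves_ext y z : (forall i, \pi_A (y i) = \pi_A (z i)) ->
  preserves e y -> preserves e z.
Proof.
by move=> yz yI p /yI /pi_eq0 H; apply/pi_eq0; rewrite -(pi_subst_ext p yz).
Qed.

Lemma preserves_comp y z : preserves e y -> preserves e z ->
  preserves e (fun j => subst y (z j)).
Proof. by move=> yI zI p pI; rewrite -subst_comp; apply/yI/zI. Qed.

End QuotientAlgebra.

Section Matrices.
Variables (k : fieldType) (n : nat) (e : rel 'I_n) (B : seq 'X_{1..n}).
Local Notation I := (edge_ideal k e).
Local Notation A := {ideal_quot I}.
Local Notation N := (size B).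
Hypothesis sB : standard_monomials I B.
Implicit Types (p q : {mpoly k[n]}) (y z u : 'I_n -> {mpoly k[n]}) (m : 'X_{1..n}).

Definition basis_mnm (i : 'I_N) : 'X_{1..n} := tnth (in_tuple B) i.

Lemma mem_basis m : (m \in B) = standard_mnm e m.
Proof. by case: sB => _ ->; rewrite edge_idealX negbK. Qed.

Lemma basis_mnm_standard i : standard_mnm e (basis_mnm i).
Proof. by rewrite -mem_basis; apply: mem_tnth. Qed.

Lemma basis_mnm_inj : injective basis_mnm.
Proof.
move=> i j; rewrite /basis_mnm !(tnth_nth 0%MM) => /eqP.
by case: sB => Bu _; rewrite nth_uniq // => /eqP /val_inj.
Qed.

Lemma basis_mnm_surj m : standard_mnm e m -> exists i, m = basis_mnm i.
Proof. by rewrite -mem_basis => /(tnthP (in_tuple B)). Qed.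

Lemma mcoeff_basis_sum (c : 'I_N -> k) i :
  (\sum_l c l *: 'X_[basis_mnm l])@_(basis_mnm i) = c i.
Proof.
rewrite raddf_sum (bigD1 i) //= big1 => [|l li]; rewrite mcoeffZ mcoeffX.
  by rewrite eqxx mulr1 addr0.
by rewrite (inj_eq basis_mnm_inj) (negPf li) mulr0.
Qed.

Lemma pi_basisP p q : \pi_A p = \pi_A q <->
  forall i, p@_(basis_mnm i) = q@_(basis_mnm i).
Proof.
rewrite pi_coeffP; split=> [pq i|pq m /basis_mnm_surj[i ->] //].
exact/pq/basis_mnm_standard.
Qed.

Lemma pi_basis_sum p : \pi_A p = \pi_A (\sum_i p@_(basis_mnm i) *: 'X_[basis_mnm i]).
Proof. by apply/pi_basisP => i; rewrite mcoeff_basis_sum. Qed.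

Definition substitution_mx y : 'M[k]_N :=
  \matrix_(i, j) (subst y 'X_[basis_mnm j])@_(basis_mnm i).

Local Notation mat := substitution_mx.

Lemma is_matrix_ofP (f : A -> A) y M :
  (forall p, f (\pi_A p) = \pi_A (subst y p)) ->
  is_matrix_of f M <-> M = mat y.
Proof.
move=> fE; split=> [fM|-> j].
  apply/matrixP => i j; rewrite mxE.
  have := fM j; rewrite fE => /pi_basisP /(_ i) -> .
  by rewrite mcoeff_basis_sum.
rewrite fE; apply/pi_basisP => i.
by rewrite (mcoeff_basis_sum (fun i => mat y i j)) mxE.
Qed.

Lemma substitution_mx_ext y z : (forall i, \pi_A (y i) = \pi_A (z i)) -> mat y = mat z.
Proof.
move=> yz; apply/matrixP => i j; rewrite !mxE.
by apply: (pi_coeffP _ _ _).1 (basis_mnm_standard i); apply: pi_subst_ext.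
Qed.

(** The image of a basis monomial under z is expanded in the basis modulo I
    before y is applied, so y has to preserve I. *)
Lemma substitution_mx_comp y z : preserves e y ->
  mat (fun j => subst y (z j)) = mat y *m mat z.
Proof.
move=> yI; apply/matrixP => i j; rewrite !mxE -subst_comp.
have [f fE] := induced_rmorphism yI.
have := congr1 f (pi_basis_sum (subst z 'X_[basis_mnm j])).
rewrite !fE => /pi_basisP /(_ i) ->; rewrite [subst y (\sum_(i | _) _)]raddf_sum [LHS]raddf_sum /=.
by apply: eq_bigr => l _; rewrite substZ mcoeffZ !mxE mulrC.
Qed.

Lemma substitution_mx_id : mat (fun i => 'X_i) = 1%:M.
Proof.
apply/matrixP => i j; rewrite !mxE subst_id mcoeffX.
by rewrite (inj_eq basis_mnm_inj) eq_sym.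
Qed.

(** The image of x_j, read off the column of the matrix that belongs to x_j.
    The sum over l has one term; it avoids choosing the index of that column.
    *)
Definition column_image (M : 'M[k]_N) (j : 'I_n) : {mpoly k[n]} :=
  \sum_i (\sum_(l | basis_mnm l == U_(j)%MM) M i l) *: 'X_[basis_mnm i].

Local Notation col_image := column_image.

Lemma column_image_mat y j : \pi_A (col_image (mat y) j) = \pi_A (y j).
Proof.
apply/pi_basisP => i; rewrite mcoeff_basis_sum.
have [l lE] := basis_mnm_surj (standard_mnm1 e j).
rewrite (big_pred1 l) => [|l']; last by rewrite lE (inj_eq basis_mnm_inj).
by rewrite mxE -lE substX.
Qed.

Lemma substitution_mx_col_image y : mat (col_image (mat y)) = mat y.
Proof. by apply: substitution_mx_ext => i; apply: column_image_mat. Qed.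

Lemma column_image_of (f : A -> A) M j : is_matrix_of f M ->
  f (\pi_A 'X_j) = \pi_A (col_image M j).
Proof.
move=> fM; have [l lE] := basis_mnm_surj (standard_mnm1 e j).
rewrite lE fM; congr (\pi_A _); apply: eq_bigr => i _; congr (_ *: _).
by rewrite (big_pred1 l) // => l'; rewrite lE (inj_eq basis_mnm_inj).
Qed.

Lemma substitution_mx_inj y z i : mat y = mat z -> \pi_A (y i) = \pi_A (z i).
Proof. by move=> yz; rewrite -column_image_mat yz column_image_mat. Qed.

Definition inverse_pair y z : Prop :=
  [/\ preserves e y, preserves e z & mat y *m mat z = 1%:M].

Lemma inverse_pairC y z : inverse_pair y z -> inverse_pair z y.
Proof. by case=> yI zI yz; split; [exact: zI | exact: yI | exact: mulmx1C yz]. Qed.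

Lemma inverse_pair_pi y z p : inverse_pair y z ->
  \pi_A (subst y (subst z p)) = \pi_A p.
Proof.
case=> yI zI yz; rewrite subst_comp -[in RHS](subst_id p).
apply: pi_subst_ext => i; apply: (@substitution_mx_inj (fun j => subst y (z j)) (fun i => 'X_i)).
by rewrite substitution_mx_comp // substitution_mx_id.
Qed.

(** An automorphism f yields y and z from the values of f and of its inverse at
    the variables. *)
Lemma AutAP M : AutA I B M <-> exists y z, inverse_pair y z /\ M = mat y.
Proof.
split=> [[f [fbij fC] fM]|[y [z [yz ->]]]]; last first.
  have [yI zI _] := yz.
  have [f fE] := induced_rmorphism yI; have [g gE] := induced_rmorphism zI.
  exists f; last exact/(is_matrix_ofP _ fE).
  split; last by move=> c; rewrite fE substC.
  exists g => a; have [p ->] := pi_surj a.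
    by rewrite fE gE; apply: inverse_pair_pi; apply: inverse_pairC.
  by rewrite gE fE; apply: inverse_pair_pi.
pose y := col_image M.
have fE : forall p, f (\pi_A p) = \pi_A (subst y p).
  by apply: rmorphism_subst => // i; apply: column_image_of.
have yI : preserves e y.
  by move=> p /pi_eq0 p0; apply/pi_eq0; rewrite -fE p0 rmorph0.
have [g fK gK] := fbij.
pose z i := repr (g (\pi_A 'X_i)).
have yz i : \pi_A (subst y (z i)) = \pi_A 'X_i by rewrite -fE reprK gK.
have zE p : f (\pi_A (subst z p)) = \pi_A p.
  by rewrite fE subst_comp -[in RHS](subst_id p); apply: pi_subst_ext.
exists y, z; split; last exact/is_matrix_ofP.
split=> //.
  move=> p /pi_eq0 p0; apply/pi_eq0; apply: (can_inj fK).
  by rewrite zE p0 rmorph0.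
by rewrite -substitution_mx_comp // -substitution_mx_id; apply: substitution_mx_ext.
Qed.

Lemma AutA_subgroup : is_subgroup (AutA I B).
Proof.
split.
- by move=> M /AutAP [y [z [[_ _ yz] ->]]] /=; exact: (mulmx1_unit yz).1.
- apply/AutAP; exists (fun i => 'X_i), (fun i => 'X_i); rewrite substitution_mx_id; split=> //.
  by split; rewrite ?substitution_mx_id ?mulmx1 // => p; rewrite subst_id.
- move=> _ _ /AutAP [y [z [[yI zI yz] ->]]] /AutAP [y' [z' [[y'I z'I y'z'] ->]]].
  apply/AutAP; exists (fun j => subst y (y' j)), (fun j => subst z' (z j)).
  split; last exact/esym/substitution_mx_comp.
  split; [exact: (preserves_comp yI y'I) | exact: (preserves_comp z'I zI) |].
  rewrite (substitution_mx_comp _ yI) (substitution_mx_comp _ z'I) mulmxA -[_ *m _ *m mat z']mulmxA.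
  by rewrite y'z' mulmx1.
move=> _ /AutAP [y [z [yz ->]]]; apply/AutAP; exists z, y.
split; first exact: inverse_pairC.
case: yz => _ _ yz; have [yu _] := mulmx1_unit yz.
by rewrite -[LHS]mulmx1 -yz mulKmx.
Qed.

(** The action on m/m^2, m being the maximal ideal of A. *)
Definition linear_part y : 'M[k]_n := \matrix_(i, j) (y j)@_U_(i).

Definition mx_linear_part (M : 'M[k]_N) : 'M[k]_n := linear_part (col_image M).

Local Notation gamma := mx_linear_part.

Lemma linear_part_ext y z : (forall i, \pi_A (y i) = \pi_A (z i)) ->
  linear_part y = linear_part z.
Proof.
move=> yz; apply/matrixP => i j; rewrite !mxE.
by apply: (pi_coeffP _ _ _).1 (yz j) _ (standard_mnm1 e i).
Qed.

Lemma mx_linear_part_mat y : gamma (mat y) = linear_part y.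
Proof. by apply: linear_part_ext => i; apply: column_image_mat. Qed.

Definition zero_const y : Prop := forall j, (y j)@_0%MM = 0.

End Matrices.

(** * Linear parts and inverses of substitutions *)

Section WeightedSubstitution.
Variables (k : fieldType) (n : nat) (w : 'X_{1..n} -> nat).
Hypothesis wD : forall m m', w (m + m')%MM = (w m + w m')%N.
Hypothesis wE : forall m, w m = (\sum_i w U_(i)%MM * m i)%N.
Implicit Types (p q : {mpoly k[n]}) (y : 'I_n -> {mpoly k[n]}).

Lemma weight_ge_subst y c p : (forall i, weight_ge w (w U_(i)%MM) (y i)) ->
  weight_ge w c p -> weight_ge w c (subst y p).
Proof.
move=> yw pc; rewrite [p]mpolyE raddf_sum /= big_seq; apply: weight_ge_sum => m.
rewrite mcoeff_msupp => /pc cm; rewrite substZ; apply: weight_geZ.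
apply: weight_ge_trans cm _; rewrite subst_mnm wE.
by apply: (weight_ge_prod wD) => i; apply: (weight_geXn wD).
Qed.

(** A substitution that adds to each variable only heavier terms adds to each
    polynomial only heavier terms. The polynomials with this property, with
    their weight bounds, are closed under products. *)
Lemma weight_ge_subst_sub y c p :
  (forall i, weight_ge w (w U_(i)%MM).+1 (y i - 'X_i)) ->
  weight_ge w c p -> weight_ge w c.+1 (subst y p - p).
Proof.
move=> yw pc.
pose R c q := weight_ge w c q /\ weight_ge w c.+1 (subst y q - q).
have RM c' d p' q : R c' p' -> R d q -> R (c' + d)%N (p' * q).
  move=> [p'c p'R] [qd qR]; split; first exact: (weight_geM wD).
  rewrite rmorphM /= (_ : _ - _ = (subst y p' - p') * ((subst y q - q) + q) +
    p' * (subst y q - q)); last first.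
    by rewrite subrK mulrBl mulrBr addrA subrK.
  apply: weight_geD; last by rewrite -addnS; apply: (weight_geM wD).
  rewrite -addSn; apply: (weight_geM wD) => //; apply: weight_geD => //.
  exact: weight_ge_trans qR.
have RX m : R (w m) 'X_[m].
  rewrite mpolyXE_id wE; elim: (index_enum _) => [|i s IHs].
    rewrite !big_nil; split; first exact: weight_ge0.
    by rewrite rmorph1 subrr; apply: weight_ge_zero.
  rewrite !big_cons; apply: (RM) => //; elim: (m i) => [|l IHl].
    rewrite muln0; split; first exact: weight_ge0.
    by rewrite rmorph1 subrr; apply: weight_ge_zero.
  rewrite exprS mulnS; apply: (RM) => //; split; first exact: weight_geX.
  by rewrite substX.
rewrite [p]mpolyE raddf_sum /= -sumrB big_seq; apply: weight_ge_sum => m.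
rewrite mcoeff_msupp => /pc cm; rewrite substZ -scalerBr; apply: weight_geZ.
by apply: weight_ge_trans (RX m).2.
Qed.

End WeightedSubstitution.

Lemma mdegE1 n (m : 'X_{1..n}) : mdeg m = (\sum_i mdeg U_(i)%MM * m i)%N.
Proof. by rewrite mdegE; apply: eq_bigr => i _; rewrite mdeg1 mul1n. Qed.

Section LinearSubstitution.
Variables (k : fieldType) (n : nat).
Implicit Types (p q : {mpoly k[n]}) (y z : 'I_n -> {mpoly k[n]}) (g h : 'M[k]_n).
Local Notation deg_ge := (weight_ge (@mdeg n)).

Definition linear_subst g j : {mpoly k[n]} := \sum_i g i j *: 'X_i.

Lemma mcoeff_lin g m j :
  (linear_subst g j)@_m = \sum_i g i j * (U_(i)%MM == m)%:R.
Proof.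
by rewrite raddf_sum; apply: eq_bigr => i _; rewrite /= mcoeffZ mcoeffX.
Qed.

Lemma mcoeff_lin1 g i j : (linear_subst g j)@_U_(i) = g i j.
Proof.
rewrite mcoeff_lin (bigD1 i) //= eqxx mulr1 big1 ?addr0 // => l li.
by rewrite eq_mnm1 (negPf li) mulr0.
Qed.

Lemma mcoeff_linN1 g m j : mdeg m != 1%N -> (linear_subst g j)@_m = 0.
Proof.
move=> m1; rewrite mcoeff_lin big1 // => i _.
by case: eqP => [mE|]; rewrite ?mulr0 //; rewrite -mE mdeg1 in m1.
Qed.

Lemma linear_part_lin g : linear_part (linear_subst g) = g.
Proof. by apply/matrixP => i j; rewrite mxE mcoeff_lin1. Qed.

Lemma zero_const_lin g : zero_const (linear_subst g).
Proof. by move=> j; apply: mcoeff_linN1; rewrite mdeg0. Qed.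

Lemma lin1 : linear_subst 1%:M = (fun j => 'X_j).
Proof.
apply/funext => j; rewrite /linear_subst (bigD1 j) //= mxE eqxx scale1r big1 ?addr0 // => i ij.
by rewrite mxE (negPf ij) scale0r.
Qed.

Lemma subst_lin y g j : subst y (linear_subst g j) = \sum_i g i j *: y i.
Proof. by rewrite raddf_sum; apply: eq_bigr => i _; rewrite /= substZ substX. Qed.

Lemma subst_lin_lin g h j : subst (linear_subst g) (linear_subst h j) = linear_subst (g *m h) j.
Proof.
rewrite subst_lin /linear_subst; under eq_bigr do rewrite scaler_sumr.
rewrite exchange_big; apply: eq_bigr => i _; rewrite mxE scaler_suml.
by apply: eq_bigr => l _; rewrite scalerA mulrC.
Qed.

Lemma deg_ge1_zero_const y : zero_const y <-> (forall j, deg_ge 1 (y j)).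
Proof.
split=> [y0 j m|y1 j].
  by rewrite lt0n mdeg_eq0; apply: contraNN => /eqP ->; rewrite y0.
by apply: contraTeq (isT) => /y1; rewrite mdeg0.
Qed.

Lemma deg_ge2_linear_part y j : zero_const y -> deg_ge 2 (y j - linear_subst (linear_part y) j).
Proof.
move=> y0 m; rewrite mcoeffB; apply: contraNT; rewrite -ltnNge ltnS leq_eqVlt.
case/orP => [/mdeg1P [i /eqP ->]|]; first by rewrite mcoeff_lin1 mxE subrr.
by rewrite ltnS leqn0 mdeg_eq0 => /eqP ->; rewrite y0 zero_const_lin subrr.
Qed.

Lemma deg_ge_subst y c p : zero_const y -> deg_ge c p -> deg_ge c (subst y p).
Proof.
move/deg_ge1_zero_const => y1; apply: (weight_ge_subst (@mdegD n) (@mdegE1 n)) => i.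
by rewrite mdeg1.
Qed.

(** Up to terms of degree at least 2, which y preserves, z is affine. *)
Lemma linear_part_comp y z : zero_const y ->
  linear_part (fun j => subst y (z j)) = linear_part y *m linear_part z.
Proof.
move=> y0; apply/matrixP => i j; rewrite !mxE.
pose z' l := z l - ((z l)@_0%MM)%:MP.
have z'0 : zero_const z'.
  by move=> l; rewrite mcoeffB mcoeffC eqxx mulr1 subrr.
have -> : subst y (z j) = ((z j)@_0%MM)%:MP +
    (subst y (linear_subst (linear_part z') j) + subst y (z' j - linear_subst (linear_part z') j)).
  by rewrite -rmorphD [linear_subst _ _ + _]addrC subrK /z' rmorphB /= substC [RHS]addrC subrK.
rewrite !mcoeffD mcoeffC mnm1_eq0 mulr0 add0r.
rewrite [X in _ + X](_ : _ = 0) ?addr0; last first.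
  apply: contraTeq (isT) => /(deg_ge_subst y0 (deg_ge2_linear_part (j := j) z'0)).
  by rewrite mdeg1.
rewrite subst_lin raddf_sum; apply: eq_bigr => l _; rewrite /= mcoeffZ !mxE mulrC.
by rewrite mcoeffB mcoeffC mnm1_eq0 mulr0 subr0.
Qed.

End LinearSubstitution.

Section AdmissibleSubstitutions.
Variables (k : fieldType) (n : nat) (e : rel 'I_n).
Hypothesis esym : ssrbool.symmetric e.
Local Notation I := (edge_ideal k e).
Local Notation A := {ideal_quot I}.
Implicit Types (p q : {mpoly k[n]}) (y z : 'I_n -> {mpoly k[n]}) (g h : 'M[k]_n).
Local Notation deg_ge := (weight_ge (@mdeg n)).

(** The relation that e_i - e_j is 0 or a root: x_i d/dx_j replaces a factor
    x_j of a relation x_j x_c by x_i. *)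
Definition root_le : rel 'I_n := fun i j => [forall c, e j c ==> e i c].

Lemma root_leP i j : reflect (forall c, e j c -> e i c) (root_le i j).
Proof. by apply: (iffP forallP) => H c; apply/implyP/H. Qed.

Lemma root_le_refl : reflexive root_le.
Proof. by move=> i; apply/root_leP. Qed.

Lemma root_le_trans : transitive root_le.
Proof. by move=> j i l /root_leP ij /root_leP jl; apply/root_leP => c /jl /ij. Qed.

(** Parametrizes what will be the identity component: the linear part lies in
    the group H of the introduction, and the terms of higher degree are
    arbitrary. *)
Definition admissible y : Prop :=
  [/\ zero_const y, mx_supported root_le (linear_part y) & linear_part y \in unitmx].

(** Expanding the product of the two forms, each term is a multiple of x_a x_b
    with root_le a i and root_le b j, and e i j implies e a j, hence e a b. *)
Lemma mul_lin_edge_ideal g i j :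
  mx_supported root_le g -> e i j -> linear_subst g i * linear_subst g j \in I.
Proof.
move=> gs eij; rewrite mulr_suml; apply: rpred_sum => a _.
rewrite mulr_sumr; apply: rpred_sum => b _.
rewrite -scalerAl -scalerAr scalerA -mul_mpolyC.
have [->|ga] := eqVneq (g a i) 0; first by rewrite mul0r mpolyC0 mul0r rpred0.
have [->|gb] := eqVneq (g b j) 0; first by rewrite mulr0 mpolyC0 mul0r rpred0.
apply: idealMr; rewrite edge_idealXX // esym.
have /root_leP := gs _ _ gb; apply; rewrite esym.
by have /root_leP := gs _ _ ga; apply.
Qed.

(** The terms of degree at least 2 contribute to the product only in degree at
    least 3. *)
Lemma mul_edge_ideal_linear_part y i j : zero_const y ->
  (y i * y j \in I) = (linear_subst (linear_part y) i * linear_subst (linear_part y) j \in I).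
Proof.
move=> y0; set l := linear_subst _.
have l1 : forall j, deg_ge 1 (l j) by apply/deg_ge1_zero_const/zero_const_lin.
have y1 : forall j, deg_ge 1 (y j) by apply/deg_ge1_zero_const.
have H : y i * y j - l i * l j \in I.
  apply: mdeg_ge3_edge_ideal.
  rewrite (_ : _ - _ = (y i - l i) * y j + l i * (y j - l j)); last first.
    by rewrite mulrBl mulrBr addrA subrK.
  apply: weight_geD.
    by rewrite -[3%N]/(2 + 1)%N; apply: (weight_geM (@mdegD n)) => //; apply: deg_ge2_linear_part.
  by rewrite -[3%N]/(1 + 2)%N; apply: (weight_geM (@mdegD n)) => //; apply: deg_ge2_linear_part.
apply/idP/idP => Hi.
  by rewrite -[X in X \in _](subKr (y i * y j)) rpredB.
by rewrite -[X in X \in _](subrK (l i * l j)) rpredD.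
Qed.

Lemma supported_preserves y : zero_const y ->
  mx_supported root_le (linear_part y) -> preserves e y.
Proof.
move=> y0 ys; apply: subst_edge_ideal => // i j eij.
by rewrite mul_edge_ideal_linear_part // mul_lin_edge_ideal.
Qed.

Lemma admissible_preserves y : admissible y -> preserves e y.
Proof. by case=> y0 ys _; apply: supported_preserves. Qed.

Lemma admissible_lin g : mx_supported root_le g -> g \in unitmx -> admissible (linear_subst g).
Proof. by move=> gs gu; split; rewrite ?linear_part_lin //; apply: zero_const_lin. Qed.

Lemma admissible_comp y z : admissible y -> admissible z -> admissible (fun j => subst y (z j)).
Proof.
case=> y0 ys yu [z0 zs zu]; split; rewrite ?linear_part_comp //.
- apply/deg_ge1_zero_const => j; apply: deg_ge_subst => //.
  by move: j; apply/deg_ge1_zero_const.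
- apply: mx_supportedM => //; exact: root_le_trans.
- by rewrite unitmx_mul yu.
Qed.

(** With g the linear part and h its inverse, y is g followed by a substitution
    tangent to the identity, up to higher terms. This suggests z_j, the sum
    over i of h_ij (x_i - q_i(h)) where q_i is the nonlinear part of y_i. The
    error subst y (z_j) - x_j is a combination of the q_i - q_i(u), where u is
    tangent to the identity; as q_i has degree at least 2, it has degree at
    least 3. *)
Lemma admissible_inverse y : admissible y ->
  exists z, [/\ admissible z, linear_part z = invmx (linear_part y)
    & forall j, \pi_A (subst y (z j)) = \pi_A 'X_j].
Proof.
case=> y0 ys yu; set g := linear_part y in ys yu *; pose h := invmx g.
pose q i := y i - linear_subst g i.
have q2 i : deg_ge 2 (q i) by apply: deg_ge2_linear_part.
pose z j := \sum_i h i j *: ('X_i - subst (linear_subst h) (q i)).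
have zlin j : deg_ge 2 (z j - linear_subst h j).
  rewrite -sumrB; apply: weight_ge_sum => i _.
  rewrite -scalerBr; apply: weight_geZ; rewrite addrAC subrr add0r.
  rewrite -scaleN1r; apply: weight_geZ; apply: deg_ge_subst => //.
  exact: zero_const_lin.
have z0 : zero_const z.
  apply/deg_ge1_zero_const => j; rewrite -[z j](subrK (linear_subst h j)).
  apply: weight_geD; first exact: weight_ge_trans (zlin j).
  by move: j; apply/deg_ge1_zero_const/zero_const_lin.
have zh : linear_part z = h.
  apply/matrixP => i j; rewrite mxE -[z j](subrK (linear_subst h j)) mcoeffD mcoeff_lin1.
  rewrite (_ : _@_ _ = 0) ?add0r //; apply/eqP; apply: contraTT (isT) => /zlin.
  by rewrite mdeg1.
exists z; split=> //.
  split=> //; rewrite zh ?unitmx_inv //.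
  by apply: mx_supportedV => //; [apply: root_le_refl | apply: root_le_trans].
move=> j; apply/pi_eqP; apply: mdeg_ge3_edge_ideal.
have uX i : deg_ge 2 (subst y (linear_subst h i) - 'X_i).
  have -> : 'X_i = linear_subst (g *m h) i by rewrite mulmxV // lin1.
  rewrite subst_lin -subst_lin_lin subst_lin -sumrB.
  by apply: weight_ge_sum => l _; rewrite -scalerBr; apply: weight_geZ; apply: q2.
have -> : subst y (z j) - 'X_j =
    \sum_i h i j *: (q i - subst y (subst (linear_subst h) (q i))).
  have -> : 'X_j = linear_subst (g *m h) j by rewrite mulmxV // lin1.
  rewrite -subst_lin_lin subst_lin raddf_sum -sumrB; apply: eq_bigr => i _ /=.
  rewrite substZ -scalerBr; congr (_ *: _); rewrite rmorphB /= substX.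
  by rewrite /q addrAC.
apply: weight_ge_sum => i _; apply: weight_geZ; rewrite -opprB -scaleN1r.
apply: weight_geZ; rewrite subst_comp.
apply: (weight_ge_subst_sub (@mdegD n) (@mdegE1 n)) => // l.
by rewrite mdeg1.
Qed.

End AdmissibleSubstitutions.

(** * Sets of automorphisms cut out by conditions on coefficients *)

Section PolynomialCoefficients.
Variables (k : fieldType) (n N : nat).
Implicit Types P Q : 'M[k]_N -> {mpoly k[n]}.

Definition polynomial_coeffs P : Prop := forall m, polynomial_fun (fun x => (P x)@_m).

Lemma polynomial_coeffs1 : polynomial_coeffs (fun=> 1).
Proof. by move=> m; apply: (function_algebra_cst (@polynomial_fun_algebra _ _)). Qed.

Lemma polynomial_coeffsM P Q :
  polynomial_coeffs P -> polynomial_coeffs Q -> polynomial_coeffs (fun x => P x * Q x).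
Proof.
move=> PP QP m; under eq_fun do rewrite mcoeffM.
have alg := @polynomial_fun_algebra k N.
by apply: (function_algebra_sum alg) => i _; apply: (function_algebraM alg).
Qed.

Lemma polynomial_coeffsX P l : polynomial_coeffs P -> polynomial_coeffs (fun x => P x ^+ l).
Proof.
move=> PP; elim: l => [|l IHl].
  by rewrite (_ : (fun _ => _) = fun=> 1); [apply: polynomial_coeffs1 | apply/funext].
rewrite (_ : (fun _ => _) = fun x => P x * P x ^+ l); last first.
  by apply/funext => x; rewrite exprS.
exact: polynomial_coeffsM.
Qed.

Lemma polynomial_coeffs_prod J (s : seq J) (F : J -> 'M[k]_N -> {mpoly k[n]}) :
  (forall j, polynomial_coeffs (F j)) -> polynomial_coeffs (fun x => \prod_(j <- s) F j x).
Proof.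
move=> FP; elim: s => [|j s IHs].
  rewrite (_ : (fun _ => _) = fun=> 1); first exact: polynomial_coeffs1.
  by apply/funext => x; rewrite big_nil.
rewrite (_ : (fun _ => _) = fun x => F j x * \prod_(j <- s) F j x); last first.
  by apply/funext => x; rewrite big_cons.
exact: polynomial_coeffsM.
Qed.

Lemma polynomial_coeffs_mnm (y : 'M[k]_N -> 'I_n -> {mpoly k[n]}) (m : 'X_{1..n}) :
  (forall j, polynomial_coeffs (fun x => y x j)) ->
  polynomial_coeffs (fun x => subst (y x) 'X_[m]).
Proof.
move=> yP; rewrite (_ : (fun _ => _) = fun x => \prod_i y x i ^+ m i).
  by apply: polynomial_coeffs_prod => i; apply: polynomial_coeffsX.
by apply/funext => x; rewrite subst_mnm.
Qed.

End PolynomialCoefficients.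

Section LinearConstraints.
Variables (k : closedFieldType) (n : nat) (e : rel 'I_n) (B : seq 'X_{1..n}).
Local Notation I := (edge_ideal k e).
Local Notation A := {ideal_quot I}.
Local Notation N := (size B).
Hypothesis e_sym : ssrbool.symmetric e.
Hypothesis sB : standard_monomials I B.
Implicit Types (y z : 'I_n -> {mpoly k[n]}) (M : 'M[k]_N) (C : 'X_{1..n} -> 'I_n -> bool).
Local Notation mat := (@substitution_mx k n B).
Local Notation col_image := (@column_image k n B).
Local Notation gamma := (@mx_linear_part k n B).

Lemma column_image_coeff m j :
  polynomial_fun (fun M => (col_image M j)@_m).
Proof.
have alg := @polynomial_fun_algebra k N.
rewrite /column_image; under eq_fun do rewrite raddf_sum /=.
apply: (function_algebra_sum alg) => i _; under eq_fun do rewrite mcoeffZ.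
apply: (function_algebraM alg); last exact: (function_algebra_cst alg).
apply: (function_algebra_sum alg) => l _; exact: polynomial_fun_entry.
Qed.

Lemma substitution_mx_col_image_polynomial : polynomial_map (fun M => mat (col_image M)).
Proof.
move=> i j; under eq_fun do rewrite mxE.
apply: polynomial_coeffs_mnm => l m; exact: column_image_coeff.
Qed.

Lemma mx_linear_part_polynomial : polynomial_map gamma.
Proof. by move=> i j; under eq_fun do rewrite mxE; apply: column_image_coeff. Qed.

Lemma column_image_affine x x' t j :
  col_image (x + t *: (x' - x)) j = col_image x j + t *: (col_image x' j - col_image x j).
Proof.
rewrite /column_image -sumrB scaler_sumr -big_split; apply: eq_bigr => i _ /=.
rewrite -scalerBl scalerA -scalerDl; congr (_ *: _).
rewrite -sumrB mulr_sumr -big_split; apply: eq_bigr => l _ /=.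
by rewrite !mxE.
Qed.

(** All the groups of automorphisms below are given by a set C of pairs (m, j)
    for which the coefficient of m in y_j is prescribed, and the prescribed
    value is always the one of the identity. *)
Definition constrained C y : Prop :=
  forall m j, standard_mnm e m -> C m j -> (y j)@_m = ('X_j : {mpoly k[n]})@_m.

Lemma constrained_ext C y z : (forall i, \pi_A (y i) = \pi_A (z i)) ->
  constrained C y -> constrained C z.
Proof.
by move=> yz yC m j sm Cm; rewrite -yC //; apply/esym; apply: (pi_coeffP _ _ _).1 (yz j) _ sm.
Qed.

Definition constrained_set C : set 'M[k]_N :=
  [set M | exists y, [/\ constrained C y, linear_part y \in unitmx & M = mat y]].

Lemma constrained_set_col C M : constrained_set C M ->
  [/\ constrained C (col_image M), gamma M \in unitmx & M = mat (col_image M)].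
Proof.
case=> y [yC yu ->].
have yz i : \pi_A (y i) = \pi_A (col_image (mat y) i) by rewrite (column_image_mat sB).
split; first exact: constrained_ext yC.
  by rewrite (mx_linear_part_mat sB).
by rewrite (substitution_mx_col_image sB).
Qed.

(** The set is the image of an open subset of the affine space of constrained
    coefficients under a polynomial map. *)
Lemma constrained_set_connected C : zariski_connected (constrained_set C).
Proof.
rewrite (_ : constrained_set C = (fun M => mat (col_image M)) @`
   ([set M | constrained C (col_image M)] `&` [set M | \det (gamma M) != 0])).
  apply: zariski_connected_affine_open.
  - exact: substitution_mx_col_image_polynomial.
  - exact/(polynomial_fun_comp mx_linear_part_polynomial)/polynomial_fun_det.
  - move=> x y t /= xC yC m j sm Cm; rewrite column_image_affine mcoeffD mcoeffZ mcoeffB.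
    by rewrite xC // yC // subrr mulr0 addr0.
apply/seteqP; split=> [M MC|_ [M [MC Mu] <-]].
  have [MC' Mu ME] := constrained_set_col MC.
  by exists M => //; split=> //=; rewrite -unitfE -unitmxE.
by exists (col_image M); split=> //; rewrite unitmxE unitfE.
Qed.

(** M is an arbitrary matrix, so that this applies to the inverse of a matrix
    that is not yet known to come from a substitution. *)
Lemma mx_linear_partM y M : zero_const y -> preserves e y ->
  gamma (mat y *m M) = linear_part y *m gamma M.
Proof.
move=> y0 yI; rewrite -linear_part_comp //; apply: (linear_part_ext (e := e)) => j.
apply/(pi_basisP sB) => i.
rewrite (mcoeff_basis_sum sB).
have [l lE] := basis_mnm_surj sB (standard_mnm1 e j).
rewrite (big_pred1 l) => [|l']; last by rewrite lE (inj_eq (basis_mnm_inj sB)).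
rewrite /column_image [subst y (\sum_(i0 | _) _)]raddf_sum [RHS]raddf_sum mxE /=; apply: eq_bigr => s _.
rewrite substZ mcoeffZ mxE mulrC; congr (_ * _).
by rewrite (big_pred1 l) // => l'; rewrite lE (inj_eq (basis_mnm_inj sB)).
Qed.

(** The constraints force zero constant terms and a linear part supported on
    the preorder, so that constrained substitutions preserve I. *)
Definition tame C : Prop := (forall j, C 0%MM j) /\
  (forall i j, ~~ root_le e i j -> C U_(i)%MM j).

Lemma constrained_zero_const C y : tame C -> constrained C y -> zero_const y.
Proof.
move=> [C0 _] yC j; rewrite yC ?standard_mnm0 //.
by rewrite mcoeffX mnm1_eq0.
Qed.

Lemma constrained_supported C y : tame C -> constrained C y ->
  mx_supported (root_le e) (linear_part y).
Proof.
move=> [_ C1] yC i j; apply: contraNT => ij; have Cij := C1 _ _ ij.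
rewrite mxE yC ?standard_mnm1 // mcoeffXU.
by have [ji|_] := eqVneq j i; rewrite ?eqxx //; rewrite ji root_le_refl in ij.
Qed.

Lemma constrained_admissible C y : tame C -> constrained C y -> linear_part y \in unitmx ->
  admissible e y.
Proof.
by move=> Ct yC yu; split=> //; [apply: constrained_zero_const yC | apply: constrained_supported yC].
Qed.

Lemma mx_linear_part_id : gamma 1%:M = 1%:M.
Proof. by rewrite -(substitution_mx_id sB) (mx_linear_part_mat sB) -lin1 linear_part_lin. Qed.

(** The equations say that the matrix is that of the substitution read off its
    columns, and that the latter is constrained. For an invertible matrix
    satisfying them, the linear part is invertible because it is
    multiplicative. *)
Lemma constrained_set_closed C : tame C ->
  exists2 Z, zariski_closed Z & constrained_set C = Z `&` [set x | x \in unitmx].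
Proof.
move=> Ct.
pose D (s : ('I_N * 'I_N) + ('X_{1..n} * 'I_n)) := match s with
  | inl _ => True | inr mj => standard_mnm e mj.1 /\ C mj.1 mj.2 end.
pose f s M : k := match s with
  | inl ij => M ij.1 ij.2 + (-1) * mat (col_image M) ij.1 ij.2
  | inr mj => (col_image M mj.2)@_(mj.1) + - ('X_(mj.2) : {mpoly k[n]})@_(mj.1) end.
exists [set M | forall s, D s -> f s M = 0].
  have alg := @polynomial_fun_algebra k N.
  apply: zariski_closed_zeros => -[[i j]|[m j]] _ /=; apply: (function_algebraD alg).
  - exact: polynomial_fun_entry.
  - apply: (function_algebraM alg); first exact: (function_algebra_cst alg).
    exact: substitution_mx_col_image_polynomial.
  - exact: column_image_coeff.
  - exact: (function_algebra_cst alg).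
apply/seteqP; split=> [M MC|M [Mf Mu]].
  have [MC' Mu ME] := constrained_set_col MC; split=> /=.
    case=> [[i j] _|[m j] [sm Cm]] /=; first by rewrite -ME mulN1r subrr.
    by rewrite MC' // subrr.
  have [z [[_ zs zu] zE yz]] := admissible_inverse (constrained_admissible Ct MC' Mu).
  have yI : preserves e (col_image M).
    by apply: admissible_preserves => //; apply: constrained_admissible Ct MC' Mu.
  have : mat (col_image M) *m mat z = 1%:M.
    by rewrite -(substitution_mx_comp sB) // -(substitution_mx_id sB); apply: (substitution_mx_ext sB).
  by rewrite -ME => /mulmx1_unit[].
have ME : M = mat (col_image M).
  apply/matrixP => i j; have := Mf (inl (i, j)) Logic.I.
  by rewrite /= mulN1r => /eqP; rewrite subr_eq0 => /eqP.
have MC : constrained C (col_image M).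
  move=> m j sm Cm; have := Mf (inr (m, j)) (conj sm Cm).
  by move=> /= /eqP; rewrite subr_eq0 => /eqP.
exists (col_image M); split=> //.
have y0 := constrained_zero_const Ct MC.
have yI : preserves e (col_image M).
  by apply: supported_preserves => //; apply: constrained_supported MC.
have := mx_linear_partM (invmx M) y0 yI; rewrite -ME mulmxV // mx_linear_part_id => /esym.
by case/mulmx1_unit.
Qed.

Lemma mx_linear_part_submx : exists s : 'I_n -> 'I_N, forall M, gamma M = mxsub s s M.
Proof.
have sP i : exists l, U_(i)%MM == basis_mnm (B := B) l.
  by have [l lE] := basis_mnm_surj sB (standard_mnm1 e i); exists l; apply/eqP.
pose s i := xchoose (sP i).
have sE i : U_(i)%MM = basis_mnm (s i) by apply/eqP/(xchooseP (sP i)).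
exists s => M; apply/matrixP => i j; rewrite !mxE sE (mcoeff_basis_sum sB).
rewrite (big_pred1 (s j)) // => l.
by rewrite sE (inj_eq (basis_mnm_inj sB)).
Qed.

Lemma substitution_mx_lin_polynomial : polynomial_map (fun g : 'M[k]_n => mat (linear_subst g)).
Proof.
have alg := @polynomial_fun_algebra k n.
move=> i j; under eq_fun do rewrite mxE; apply: polynomial_coeffs_mnm => l m.
under eq_fun do rewrite mcoeff_lin; apply: (function_algebra_sum alg) => a _.
apply: (function_algebraM alg); last exact: (function_algebra_cst alg).
exact: polynomial_fun_entry.
Qed.

Lemma substitution_mx_linM g h : mx_supported (root_le e) g ->
  mat (linear_subst (g *m h)) = mat (linear_subst g) *m mat (linear_subst h).
Proof.
move=> gs; rewrite -(substitution_mx_comp sB); last first.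
  by apply: supported_preserves => //; rewrite ?linear_part_lin //; apply: zero_const_lin.
by congr (substitution_mx _); apply/funext => j; rewrite subst_lin_lin.
Qed.

Lemma mx_linear_part_mat_lin g : gamma (mat (linear_subst g)) = g.
Proof. by rewrite (mx_linear_part_mat sB) linear_part_lin. Qed.

Lemma substitution_mx_lin1 : mat (linear_subst 1%:M) = 1%:M.
Proof. by rewrite lin1 (substitution_mx_id sB). Qed.

Lemma admissible_AutA y : admissible e y -> AutA I B (mat y).
Proof.
move=> yg; apply/(AutAP sB).
have [z [zg _ yz]] := admissible_inverse yg; exists y, z; split=> //; split.
- exact: admissible_preserves.
- exact: admissible_preserves.
- rewrite -(substitution_mx_comp sB); last exact: admissible_preserves.
  by rewrite -(substitution_mx_id sB); apply: (substitution_mx_ext sB).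
Qed.

End LinearConstraints.

(** * The homomorphism onto the block diagonal group and its unipotent kernel *)

Section Complements.
Variables (k : fieldType) (N : nat) (H U : set 'M[k]_N).
Hypotheses (Hg : is_subgroup H) (Ug : is_subgroup U).

(** The factorization x = u y with u in U and y in M is unique. *)
Lemma complement_projection M q x u y : is_subgroup M -> U `&` M = [set 1%:M] ->
  (forall x, H x -> M (q x) /\ U (x *m invmx (q x))) ->
  H x -> U u -> M y -> x = u *m y -> q x = y.
Proof.
move=> [Munit _ MM Minv] UM qP Hx Uu My xE.
have [Uunit _ UMul Uinv] := Ug.
have [Mq Uq] := qP x Hx.
have qu : q x \in unitmx := Munit _ Mq.
have yu : y \in unitmx := Munit _ My.
have uu : u \in unitmx := Uunit _ Uu.
have : (U `&` M) (y *m invmx (q x)).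
  split; last by apply: MM => //; apply: Minv.
  have -> : y *m invmx (q x) = invmx u *m (x *m invmx (q x)).
    by rewrite xE !mulmxA mulVmx // mul1mx.
  by apply: UMul => //; apply: Uinv.
rewrite UM /= => yq.
by rewrite -[RHS](mulmxKV qu) yq mul1mx.
Qed.

(** The projections onto the two complements along U restrict to mutually
    inverse isomorphisms. *)
Lemma complements_iso M1 M2 : is_subgroup M1 -> is_subgroup M2 ->
  is_semidirect_product H U M1 -> is_semidirect_product H U M2 -> alg_iso M1 M2.
Proof.
move=> M1g M2g [[UH Un] M1H UM1 [q1 q1R q1P]] [_ M2H UM2 [q2 q2R q2P]].
have [Hunit _ HM _] := Hg; have [Uunit _ UM Uinv] := Ug.
have [M1unit _ _ _] := M1g; have [M2unit _ _ _] := M2g.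
have key (Ma Mb : set 'M[k]_N) qa qb x : is_subgroup Ma -> is_subgroup Mb -> Ma `<=` H ->
    Mb `<=` H -> U `&` Ma = [set 1%:M] ->
    (forall x, H x -> Ma (qa x) /\ U (x *m invmx (qa x))) ->
    (forall x, H x -> Mb (qb x) /\ U (x *m invmx (qb x))) ->
    Ma x -> qa (qb x) = x.
  move=> Mag Mbg MaH MbH UMa qaP qbP Max; have Hx := MaH _ Max.
  have [Mbq Uq] := qbP x Hx; have [Mbu _ _ _] := Mbg.
  have qu : qb x \in unitmx := Mbu _ Mbq.
  have xu : x \in unitmx := Hunit _ Hx.
  apply: (complement_projection Mag UMa qaP (MbH _ Mbq) (Uinv _ Uq) Max).
  apply: (can_inj (mulKmx (Uunit _ Uq))).
  by rewrite mulmxA mulmxV ?(Uunit _ Uq) // mul1mx mulmxKV.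
exists q2, q1; split.
- by split=> i j; [exact: (regular_on_subset M1H (q2R i j)) | exact: (regular_on_subset M2H (q1R i j))].
- by move=> x /M1H /q2P[].
- by move=> x /M2H /q1P[].
- move=> x y M1x M1y; have [Hx Hy] := (M1H _ M1x, M1H _ M1y).
  have [Mx Ux] := q2P x Hx; have [My Uy] := q2P y Hy.
  have xu : q2 x \in unitmx := M2unit _ Mx.
  have yu : q2 y \in unitmx := M2unit _ My.
  have M2M : M2 (q2 x *m q2 y) by have [_ _ MM _] := M2g; apply: MM.
  apply: (complement_projection M2g UM2 q2P (HM _ _ Hx Hy)
    (UM _ _ Ux (Un _ _ (M2H _ Mx) Uy)) M2M).
  rewrite !mulmxA mulmxKV // mulmxKV //.
  by rewrite -!mulmxA mulKmx // !mulmxA mulmxKV.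
- split=> x Mx; first exact: (key M1 M2 q1 q2 x M1g M2g M1H M2H UM1 q1P q2P Mx).
  exact: (key M2 M1 q2 q1 x M2g M1g M2H M1H UM2 q2P q1P Mx).
Qed.

End Complements.

Lemma reductive_subgroup (k : fieldType) N (M : set 'M[k]_N) :
  is_reductive M -> is_subgroup M.
Proof. by case=> -[]. Qed.

Lemma unipotent_radical_unique (k : fieldType) N (H U U' : set 'M[k]_N) :
  is_unipotent_radical H U -> is_unipotent_radical H U' -> U = U'.
Proof.
move=> [Uc Umax] [U'c U'max]; apply/seteqP.
by split; [apply: U'max | apply: Umax].
Qed.

Lemma levi_subgroup_iso_of (k : fieldType) N N' (G M U : set 'M[k]_N) (L : set 'M[k]_N') :
  is_subgroup (identity_component G) -> is_subgroup L ->
  is_reductive M -> is_unipotent_radical (identity_component G) U ->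
  is_semidirect_product (identity_component G) U M -> alg_iso M L ->
  levi_subgroup_iso G L.
Proof.
move=> G0g Lg Mr Urad Usd ML; split.
  by exists M; split=> //; exists U.
move=> M' [M'r [U' U'rad U'sd]].
have UU' := unipotent_radical_unique U'rad Urad; rewrite UU' in U'sd.
have Mg := reductive_subgroup Mr; have M'g := reductive_subgroup M'r.
have Ug : is_subgroup U by case: Urad => -[[]].
exact: (alg_iso_trans M'g Mg Lg (complements_iso G0g Ug M'g Mg U'sd Usd) ML).
Qed.

Section Structure.
Variables (k : closedFieldType) (n : nat) (e : rel 'I_n) (B : seq 'X_{1..n}).
Local Notation I := (edge_ideal k e).
Local Notation A := {ideal_quot I}.
Local Notation N := (size B).
Hypothesis e_sym : ssrbool.symmetric e.
Hypothesis sB : standard_monomials I B.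
Variable b : 'I_n -> nat.
Hypothesis le_b : forall i j, root_le e i j -> (b i <= b j)%N.
Hypothesis b_le : forall i j, b i = b j -> root_le e i j.
Implicit Types (y z : 'I_n -> {mpoly k[n]}) (M : 'M[k]_N) (g h d : 'M[k]_n).
Local Notation mat := (@substitution_mx k n B).
Local Notation gamma := (@mx_linear_part k n B).
Local Notation lexx := (@root_le_refl n e).
Local Notation letr := (@root_le_trans n e).

Local Notation block_rel := (same_block b).

Definition linear_automorphisms le : set 'M[k]_N := (fun g => mat (linear_subst g)) @` supported_units le.

Local Notation linear_autos := linear_automorphisms.

Lemma linear_automorphisms_subgroup le : reflexive le -> transitive le ->
  subrel le (root_le e) -> is_subgroup (linear_autos le).
Proof.
move=> rfl tr le_e; have [_ g1 gM gV] := supported_units_subgroup k rfl tr.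
have sub g : supported_units le g -> mx_supported (root_le e) g.
  by move=> [_ gs] i j /gs /le_e.
have inv g : supported_units le g -> mat (linear_subst g) *m mat (linear_subst (invmx g)) = 1%:M.
  by move=> ge; rewrite -(substitution_mx_linM e_sym sB) ?mulmxV ?(substitution_mx_lin1 sB) //; [case: ge | apply: sub].
split.
- by move=> _ [g ge <-]; exact: (mulmx1_unit (inv g ge)).1.
- by exists 1%:M => //; rewrite (substitution_mx_lin1 sB).
- move=> _ _ [g ge <-] [h he <-]; exists (g *m h); first exact: gM.
  by rewrite (substitution_mx_linM e_sym sB) //; apply: sub.
- move=> _ [g ge <-]; exists (invmx g); first exact: gV.
  have [gu _] := mulmx1_unit (inv g ge).
  by apply: (can_inj (mulKmx gu)); rewrite inv // mulmxV.
Qed.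

Definition linear_constraints (le : rel 'I_n) (m : 'X_{1..n}) (j : 'I_n) : bool :=
  (mdeg m != 1%N) || [exists i, (m == U_(i)%MM) && ~~ le i j].

Lemma linear_automorphismsE le : reflexive le -> subrel le (root_le e) ->
  linear_autos le = constrained_set (B := B) e (linear_constraints le).
Proof.
move=> rfl le_e; apply/seteqP; split=> [_ [g [gu gs] <-]|_ [y [yC yu ->]]].
  exists (linear_subst g); split; rewrite ?linear_part_lin //.
  move=> m j _; rewrite /linear_constraints; case: eqVneq => [m1 /=|m1 _]; last first.
    by rewrite mcoeff_linN1 // mcoeffX; case: eqVneq => // mj; rewrite -mj mdeg1 in m1.
  move=> /existsP[i /andP[/eqP -> ij]].
  rewrite mcoeff_lin1 (mx_supported0 gs) // mcoeffXU.
  by have [ji|//] := eqVneq j i; rewrite ji rfl in ij.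
exists (linear_part y).
  split=> // i j; apply: contraNT => ij; rewrite mxE yC ?standard_mnm1 //.
    by rewrite mcoeffXU; have [ji|] := eqVneq j i; rewrite ?eqxx //; rewrite ji rfl in ij.
  by rewrite /linear_constraints mdeg1 /=; apply/existsP; exists i; rewrite eqxx.
apply: (substitution_mx_ext sB) => j; apply/pi_coeffP => m sm.
have [m1|m1] := eqVneq (mdeg m) 1%N.
  by move/eqP: m1 => /mdeg1P[i /eqP ->]; rewrite mcoeff_lin1 mxE.
rewrite mcoeff_linN1 // yC //; last by rewrite /linear_constraints m1.
by rewrite mcoeffX; case: eqVneq => // mj; rewrite -mj mdeg1 in m1.
Qed.

Lemma linear_constraints_tame le : subrel le (root_le e) ->
  tame e (linear_constraints le).
Proof.
move=> le_e; split=> [j|i j ij]; rewrite /linear_constraints ?mdeg0 //.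
by rewrite mdeg1 /=; apply/existsP; exists i; rewrite eqxx; apply: contra ij; apply: le_e.
Qed.

(** This set turns out to be the identity component of Aut A. *)
Definition supported_autos : set 'M[k]_N := [set M | exists2 y, admissible e y & M = mat y].

Local Notation autos := supported_autos.

Definition supp_constraints (m : 'X_{1..n}) (j : 'I_n) : bool :=
  (m == 0%MM) || [exists i, (m == U_(i)%MM) && ~~ root_le e i j].

Lemma supp_constraints_tame : tame e supp_constraints.
Proof.
split=> [j|i j ij]; rewrite /supp_constraints ?eqxx //.
by apply/orP; right; apply/existsP; exists i; rewrite eqxx.
Qed.

Lemma supported_autosE : autos = constrained_set (B := B) e supp_constraints.
Proof.
apply/seteqP; split=> [_ [y [y0 ys yu] ->]|_ [y [yC yu ->]]]; last first.
  by exists y => //; apply: constrained_admissible supp_constraints_tame yC yu.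
exists y; split=> // m j _ /orP[/eqP ->|/existsP[i /andP[/eqP -> ij]]].
  by rewrite y0 mcoeffX mnm1_eq0.
have := mx_supported0 ys ij; rewrite mxE => ->; rewrite mcoeffXU.
by have [ji|//] := eqVneq j i; rewrite ji lexx in ij.
Qed.

Lemma supported_autos_subgroup : is_subgroup autos.
Proof.
have inv y : admissible e y -> exists2 z, admissible e z & mat y *m mat z = 1%:M.
  move=> yg; have [z [zg _ yz]] := admissible_inverse yg; exists z => //.
  rewrite -(substitution_mx_comp sB); last exact: admissible_preserves.
  by rewrite -(substitution_mx_id sB); apply: (substitution_mx_ext sB).
split.
- by move=> _ [y yg ->]; have [z _ yz] := inv y yg; exact: (mulmx1_unit yz).1.
- exists (linear_subst 1%:M); last by rewrite (substitution_mx_lin1 sB).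
  by apply: admissible_lin; [apply/mx_supported1/lexx | apply: unitmx1].
- move=> _ _ [y yg ->] [z zg ->]; exists (fun j => subst y (z j)); first exact: admissible_comp.
  by rewrite (substitution_mx_comp sB) //; apply: admissible_preserves.
- move=> _ [y yg ->]; have [z zg yz] := inv y yg; exists z => //.
  have [yu _] := mulmx1_unit yz.
  by apply: (can_inj (mulKmx yu)); rewrite yz mulmxV.
Qed.

Lemma supported_autos_connected : zariski_connected autos.
Proof. by rewrite supported_autosE; apply: constrained_set_connected. Qed.

Lemma supported_autos_AutA : autos `<=` AutA I B.
Proof. by move=> _ [y yg ->]; apply: admissible_AutA. Qed.

(** The quotient map of the identity component by its unipotent radical,
    composed with the isomorphism of the quotient with L. *)
Definition block_linear_part M : 'M[k]_n := block_part b (gamma M).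

Local Notation psi := block_linear_part.

Lemma block_linear_partM M M' : autos M -> autos M' -> psi (M *m M') = psi M *m psi M'.
Proof.
move=> [y yg ->] [z zg ->].
have [[y0 ys _] [z0 zs _]] := (yg, zg).
rewrite /psi (mx_linear_partM sB) //; last exact: admissible_preserves.
by rewrite (mx_linear_part_mat sB y) (mx_linear_part_mat sB z); exact: (block_partM le_b ys zs).
Qed.

Lemma block_linear_part1 : psi 1%:M = 1%:M.
Proof. by rewrite /psi (mx_linear_part_id sB) block_part1. Qed.

Lemma block_linear_part_block M : autos M -> supported_units block_rel (psi M).
Proof.
move=> [y [y0 ys yu] ->]; rewrite /psi (mx_linear_part_mat sB); split.
  by apply: (block_part_unit le_b) => //; [apply: lexx | apply: letr].
exact: block_part_supported.
Qed.

Lemma block_linear_part_lin d : mx_supported block_rel d -> psi (mat (linear_subst d)) = d.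
Proof. by move=> ds; rewrite /psi (mx_linear_part_mat_lin sB) block_part_id. Qed.

Lemma linear_automorphisms_sub le : subrel le (root_le e) -> linear_autos le `<=` autos.
Proof.
move=> le_e _ [g [gu gs] <-]; exists (linear_subst g) => //; apply: admissible_lin => //.
by move=> i j /gs /le_e.
Qed.

Lemma same_block_sub_root_le : subrel block_rel (root_le e).
Proof. by move=> i j /eqP /b_le. Qed.

Lemma block_linear_partV M : autos M -> psi M *m psi (invmx M) = 1%:M.
Proof.
move=> KM; have [Kunit _ _ Kinv] := supported_autos_subgroup.
by rewrite -block_linear_partM ?mulmxV ?block_linear_part1 //; [apply: Kunit | apply: Kinv].
Qed.

(** The map is linear on all matrices and multiplicative on the powers of M, so
    it sends M^a (M - 1)^s to the corresponding expression in the image of M,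
    by induction on s. *)
Lemma block_linear_part_unipotent M l : autos M -> (M - 1%:M) ^+ l = 0 -> (psi M - 1%:M) ^+ l = 0.
Proof.
move=> KM Ml; have [s sE] := mx_linear_part_submx sB.
have psi_sub x x' : psi (x - x') = psi x - psi x'.
  apply/matrixP => i j; rewrite /psi !sE !mxE.
  by case: ifP; rewrite ?subr0.
have [_ K1 KMul _] := supported_autos_subgroup.
have KX a : autos (M ^+ a).
  by elim: a => [//|a IHa]; rewrite exprS; apply: KMul.
have psiX a : psi (M ^+ a) = psi M ^+ a.
  by elim: a => [|a IHa]; rewrite ?expr0 ?block_linear_part1 // !exprS block_linear_partM // IHa.
suff H : forall s a, psi (M ^+ a *m (M - 1%:M) ^+ s) = psi M ^+ a *m (psi M - 1%:M) ^+ s.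
  have := H l 0%N; rewrite Ml mulmx0 !expr0 mul1mx => <-.
  by rewrite -[0](subrr 0) psi_sub subrr.
elim=> [|t IHt] a; first by rewrite !expr0 !mulmx1 psiX.
have split_step (R : pzRingType) (x : R) c :
    x ^+ c * (x - 1) ^+ t.+1 = x ^+ c.+1 * (x - 1) ^+ t - x ^+ c * (x - 1) ^+ t.
  by rewrite exprS mulrA mulrBr mulr1 mulrBl -exprSr.
rewrite [_ *m _]split_step psi_sub !IHt.
by rewrite [RHS]split_step.
Qed.

Definition unipotent_autos : set 'M[k]_N := [set M | autos M /\ psi M = 1%:M].

Local Notation uni := unipotent_autos.

Definition unipotent_autos_constraints m j : bool :=
  supp_constraints m j || [exists i, (m == U_(i)%MM) && (b i == b j)].

Lemma unipotent_autos_constraints_tame : tame e unipotent_autos_constraints.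
Proof.
have [t0 t1] := supp_constraints_tame.
by split=> [j|i j ij]; rewrite /unipotent_autos_constraints ?t0 ?t1.
Qed.

Lemma unipotent_autosE : uni = constrained_set (B := B) e unipotent_autos_constraints.
Proof.
apply/seteqP; split=> [M [KM psiM1]|M [y [yC yu ME]]].
  move: KM psiM1; rewrite supported_autosE => -[y [yC yu ->]] block_linear_part1'.
  exists y; split=> // m j sm /orP[|/existsP[i /andP[/eqP -> bij]]]; first exact: yC.
  have := congr1 (fun g : 'M_n => g i j) block_linear_part1'.
  by rewrite /psi (mx_linear_part_mat sB) !mxE bij mcoeffXU eq_sym.
have KM : autos M.
  rewrite supported_autosE; exists y; split=> // m j sm Cm; apply: yC => //.
  by rewrite /unipotent_autos_constraints Cm.
split=> //; rewrite ME /psi (mx_linear_part_mat sB); apply/matrixP => i j; rewrite !mxE.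
case: ifP => [bij|bij]; last by have [ij|//] := eqVneq i j; rewrite ij eqxx in bij.
rewrite yC ?standard_mnm1 // ?mcoeffXU 1?eq_sym //.
by apply/orP; right; apply/existsP; exists i; rewrite eqxx.
Qed.

Lemma unipotent_autos_subgroup : is_subgroup uni.
Proof.
have [Kunit K1 KM KV] := supported_autos_subgroup; split.
- by move=> M [/Kunit].
- by split=> //; apply: block_linear_part1.
- by move=> M M' [KM1 p1] [KM2 p2]; split; [apply: KM | rewrite block_linear_partM // p1 p2 mulmx1].
- by move=> M [KM1 p1]; split; [apply: KV | rewrite -[LHS]mul1mx -p1 block_linear_partV].
Qed.

Lemma unipotent_autos_normal : is_normal_in uni autos.
Proof.
have [Kunit K1 KM KV] := supported_autos_subgroup.
split=> [M []//|x u Kx [Ku pu]].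
have Kxu : autos (x *m u) by apply: KM.
split; first by apply: KM => //; apply: KV.
by rewrite block_linear_partM ?block_linear_partM ?pu ?mulmx1 ?block_linear_partV //; apply: KV.
Qed.

(** Give x_i the weight 2R + 1 - b i, where R exceeds all b i. A variable of an
    earlier block is heavier, and as all weights lie between R + 2 and 2R + 1,
    every product of two variables is heavier than each variable. So M - 1
    raises the weight of each basis monomial. *)
Lemma unipotent_autos_unipotent : is_unipotent uni.
Proof.
move=> M; rewrite unipotent_autosE => /(constrained_set_col sB)[].
set y := column_image M => yC _ ME.
pose R := (\max_i b i).+1.
have bR i : (b i < R)%N by rewrite ltnS; apply: leq_bigmax.
pose w (m : 'X_{1..n}) := (\sum_i (2 * R + 1 - b i) * m i)%N.
have wD m m' : w (m + m')%MM = (w m + w m')%N.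
  by rewrite /w -big_split; apply: eq_bigr => i _; rewrite mnmDE mulnDr.
have w1 i : w U_(i)%MM = (2 * R + 1 - b i)%N.
  rewrite /w (bigD1 i) //= mnm1E eqxx muln1 big1 ?addn0 // => j ji.
  by rewrite mnm1E eq_sym (negPf ji) muln0.
have wE m : w m = (\sum_i w U_(i)%MM * m i)%N.
  by apply: eq_bigr => i _; rewrite w1.
have w2 m : ((R + 2) * mdeg m <= w m)%N.
  rewrite mdegE big_distrr; apply: leq_sum => i _ /=.
  rewrite leq_mul2r; apply/orP; right.
  have := bR i; lia.
have yw i : weight_ge w (w U_(i)%MM).+1 (y i - 'X_i).
  have [t0 _] := unipotent_autos_constraints_tame; move=> m; rewrite mcoeffB => nz.
  have := w2 m; rewrite w1.
  have [m0|m0] := eqVneq m 0%MM.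
    by move: nz; rewrite m0 mcoeffX mnm1_eq0 (constrained_zero_const unipotent_autos_constraints_tame yC) subrr eqxx.
  have [m1|m1] := eqVneq (mdeg m) 1%N; last first.
    have : (1 < mdeg m)%N by move: m0 m1; rewrite -mdeg_eq0; lia.
    by have := bR i; nia.
  move/eqP: m1 => /mdeg1P[j /eqP mE] _; rewrite mE w1.
  have ji : root_le e j i.
    apply: contraNT nz => ji; rewrite mE yC ?subrr ?standard_mnm1 //.
    by rewrite /unipotent_autos_constraints; have [_ ->] := supp_constraints_tame.
  have bji : b j != b i.
    apply: contraNN nz => bji; rewrite mE yC ?subrr ?standard_mnm1 //.
    by apply/orP; right; apply/existsP; exists j; rewrite eqxx.
  by have := le_b ji; have := bR i; have := bR j; lia.
have Mw i j : (M - 1%:M) i j != 0 ->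
    ((w (basis_mnm (B := B) j)).+1 <= w (basis_mnm (B := B) i))%N.
  rewrite ME -(substitution_mx_id sB) !mxE subst_id -mcoeffB.
  apply: (weight_ge_subst_sub wD wE yw (c := w (basis_mnm j))).
  exact: weight_geX.
have Mlw l i j : ((M - 1%:M) ^+ l) i j != 0 ->
    (w (basis_mnm (B := B) j) + l <= w (basis_mnm (B := B) i))%N.
  elim: l i j => [|l IHl] i j.
    by rewrite expr0 mxE addn0; have [->|_] := eqVneq i j; rewrite ?eqxx.
  rewrite exprSr mxE => nz.
  have [s] : exists s, ((M - 1%:M) ^+ l) i s * (M - 1%:M) s j != 0.
    apply/existsP; apply: contraNT nz; rewrite negb_exists => /forallP nz.
    by rewrite big1 // => s _; apply/eqP; have := nz s; rewrite negbK.
  rewrite mulf_eq0 negb_or => /andP[/IHl H1 /Mw H2].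
  by apply: leq_trans H1; rewrite addnS -addSn leq_add2r.
exists (\max_i w (basis_mnm (B := B) i)).+1; apply/matrixP => i j; rewrite [RHS]mxE.
apply: contraTeq (isT) => /Mlw; rewrite addnS => H.
have := leq_bigmax (F := fun i => w (basis_mnm (B := B) i)) i.
by rewrite leqNgt (leq_trans _ H) // ltnS leq_addl.
Qed.

End Structure.

(** * The unipotent radical and the Levi subgroup of Aut A *)

Section Radical.
Variables (k : closedFieldType) (n : nat) (e : rel 'I_n) (B : seq 'X_{1..n}).
Local Notation I := (edge_ideal k e).
Local Notation A := {ideal_quot I}.
Local Notation N := (size B).
Hypothesis e_sym : ssrbool.symmetric e.
Hypothesis sB : standard_monomials I B.
Variable b : 'I_n -> nat.
Hypothesis le_b : forall i j, root_le e i j -> (b i <= b j)%N.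
Hypothesis b_le : forall i j, b i = b j -> root_le e i j.
Implicit Types (y z : 'I_n -> {mpoly k[n]}) (M : 'M[k]_N) (g h d : 'M[k]_n).
Local Notation mat := (@substitution_mx k n B).
Local Notation gamma := (@mx_linear_part k n B).


Local Notation autos := (@supported_autos k n e B).
Local Notation uni := (@unipotent_autos k n e B b).
Local Notation psi := (@block_linear_part k n B b).
Local Notation block_rel := (same_block b).
Local Notation linear_autos := (@linear_automorphisms k n B).

(** The image of V in L consists of unipotent matrices and is stable under
    conjugation by transvections. *)
Lemma block_linear_part_trivial (V : set 'M[k]_N) : V `<=` autos ->
  (forall x x', V x -> V x' -> V (x *m x')) ->
  (forall x v, linear_autos block_rel x -> V v -> V (x *m v *m invmx x)) ->
  is_unipotent V -> forall v, V v -> psi v = 1%:M.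
Proof.
move=> Vsub VM Vconj Vu v Vv; have [_ _ KM KV] := supported_autos_subgroup e_sym sB.
apply: (@normal_unipotent_block_diag k n b (psi @` V)); last by exists v.
- by move=> _ [x /Vsub Kx <-]; have [] := block_linear_part_block sB le_b Kx.
- move=> _ _ [x Vx <-] [x' Vx' <-]; exists (x *m x'); first exact: VM.
  by rewrite (block_linear_partM e_sym sB le_b) //; apply: Vsub.
- move=> _ i j [x Vx <-] bij ij; have Kx := Vsub _ Vx.
  pose g : 'M[k]_n := 1%:M + delta_mx i j.
  have gV : g *m (1%:M - delta_mx i j) = 1%:M.
    by have := @transvection_inv k n i j 1 ij; rewrite scale1r.
  have [gu _] := mulmx1_unit gV.
  have gs : mx_supported block_rel g.
    move=> a c; rewrite !mxE; have [->|_] := eqVneq a c; first by rewrite same_block_refl.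
    by rewrite add0r; case: andP => [[/eqP -> /eqP ->] _|_]; rewrite ?eqxx // /same_block bij.
  have Lg : linear_autos block_rel (mat (linear_subst g)) by exists g.
  have Kg : autos (mat (linear_subst g)).
    exact: (linear_automorphisms_sub (B := B) (same_block_sub_root_le b_le)).
  exists (mat (linear_subst g) *m x *m invmx (mat (linear_subst g))); first exact: Vconj.
  rewrite (block_linear_partM e_sym sB le_b (KM _ _ Kg Kx) (KV _ Kg)) (block_linear_partM e_sym sB le_b Kg Kx).
  rewrite (block_linear_part_lin sB) //.
  have := block_linear_partV e_sym sB le_b Kg; rewrite (block_linear_part_lin sB) // => gp.
  congr (_ *m _); apply: (can_inj (mulKmx gu)).
  by rewrite gp gV.
- move=> _ [x Vx <-]; have [l xl] := Vu x Vx; exists l.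
  by apply: (block_linear_part_unipotent e_sym sB le_b) => //; apply: Vsub.
Qed.

Lemma unipotent_autos_radical : is_unipotent_radical autos uni.
Proof.
split.
  split; first split; first exact: (unipotent_autos_subgroup e_sym sB le_b).
  - rewrite (unipotent_autosE sB); apply: (constrained_set_closed e_sym sB); exact: unipotent_autos_constraints_tame.
  - by rewrite (unipotent_autosE sB); apply: constrained_set_connected.
  - exact: (unipotent_autos_normal e_sym sB le_b).
  - exact: (unipotent_autos_unipotent sB le_b).
move=> V [[[_ _ VM _] _] _ [VK Vn] Vu] v Vv; split; first exact: VK.
apply: (@block_linear_part_trivial V) => // x u Lx; apply: Vn.
exact: (linear_automorphisms_sub (B := B) (same_block_sub_root_le b_le)) Lx.
Qed.

Lemma linear_automorphisms_closed le : reflexive le -> transitive le -> subrel le (root_le e) ->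
  is_closed_subgroup (linear_autos le).
Proof.
move=> rfl tr le_e; split; first exact: (linear_automorphisms_subgroup e_sym sB rfl tr le_e).
rewrite (linear_automorphismsE sB rfl le_e).
exact/(constrained_set_closed e_sym sB)/linear_constraints_tame.
Qed.

Lemma linear_automorphisms_connected le : reflexive le -> subrel le (root_le e) ->
  zariski_connected (linear_autos le).
Proof.
by move=> rfl le_e; rewrite (linear_automorphismsE sB rfl le_e); apply: constrained_set_connected.
Qed.

Lemma set1_closed_subgroup (N' : nat) : is_closed_subgroup [set (1%:M : 'M[k]_N')].
Proof.
have alg := @polynomial_fun_algebra k N'.
split.
  split=> //= [_ ->|_ _ -> ->|_ ->]; first exact: unitmx1.
    by rewrite mulmx1.
  by rewrite -[RHS]mulmx1 -[LHS]mulmx1 mulVmx ?mulmx1 ?unitmx1.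
exists [set x | forall ij, True -> x ij.1 ij.2 + - (1%:M : 'M[k]_N') ij.1 ij.2 = 0].
  apply: (zariski_closed_zeros (D := fun=> True)) => -[i j] _ /=.
  apply: (function_algebraD alg); first exact: polynomial_fun_entry.
  exact: (function_algebra_cst alg).
apply/seteqP; split=> [_ ->|x [xE _]] /=.
  by split=> [ij _|]; [rewrite subrr | apply: unitmx1].
apply/matrixP => i j; apply/eqP; rewrite -subr_eq0.
by apply/eqP/(xE (i, j)).
Qed.

Lemma block_autos_reductive : is_reductive (linear_autos block_rel).
Proof.
have rfl := @same_block_refl n b; have tr := @same_block_trans n b.
have le_e := same_block_sub_root_le b_le.
have Lg := linear_automorphisms_subgroup e_sym sB rfl tr le_e.
have Lsub : linear_autos block_rel `<=` autos := linear_automorphisms_sub le_e.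
split; first exact: linear_automorphisms_closed.
split.
  split; first exact: set1_closed_subgroup.
  - exact: zariski_connected_set1.
  - have [Lu L1 _ _] := Lg; split=> [_ -> //|x _ Lx ->] /=.
    by rewrite mulmx1 mulmxV //; apply: Lu.
  - by move=> _ ->; exists 1%N; rewrite subrr expr1.
move=> V [[[_ _ VM _] _] _ [VL Vn] Vu] v Vv /=.
have pv : psi v = 1%:M by apply: (@block_linear_part_trivial V) => // x /VL /Lsub.
have [d [_ ds] dE] := VL _ Vv; move: pv; rewrite -dE (block_linear_part_lin sB) // => ->.
exact: (substitution_mx_lin1 sB).
Qed.

Lemma block_linear_part_polynomial : polynomial_map psi.
Proof.
move=> i j; under eq_fun do rewrite mxE; case: (b i == b j).
  exact: mx_linear_part_polynomial.
exact: (function_algebra_cst (@polynomial_fun_algebra k N)).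
Qed.

Lemma supported_autos_semidirect : is_semidirect_product autos uni (linear_autos block_rel).
Proof.
have rfl := @same_block_refl n b; have tr := @same_block_trans n b.
have le_e := same_block_sub_root_le b_le.
have [_ L1 LM LV] := linear_automorphisms_subgroup e_sym sB rfl tr le_e.
have Lsub : linear_autos block_rel `<=` autos := linear_automorphisms_sub le_e.
have [_ U1 _ _] := unipotent_autos_subgroup e_sym sB le_b.
have [Ku _ KM KV] := supported_autos_subgroup e_sym sB.
split; [exact: (unipotent_autos_normal e_sym sB le_b)|exact: Lsub| |].
  apply/seteqP; split=> [x [[_ pd] [d [_ ds] dE]] /=|_ ->]; last by split.
  by move: pd; rewrite -dE (block_linear_part_lin sB) // => ->; apply: (substitution_mx_lin1 sB).
exists (fun x => mat (linear_subst (psi x))).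
  move=> i j; apply: polynomial_regular_on.
  exact: (polynomial_map_comp block_linear_part_polynomial (@substitution_mx_lin_polynomial k n B)).
move=> x Kx; have Lx := block_linear_part_block sB le_b Kx.
have Lq : linear_autos block_rel (mat (linear_subst (psi x))) by exists (psi x).
have Kq := Lsub _ Lq.
split=> //; split; first by apply: KM => //; apply: KV.
rewrite (block_linear_partM e_sym sB le_b) //; last exact: KV.
by have := block_linear_partV e_sym sB le_b Kq; rewrite (block_linear_part_lin sB) //; case: Lx.
Qed.

Lemma linear_automorphisms_iso le : reflexive le -> transitive le -> subrel le (root_le e) ->
  alg_iso (linear_autos le) (@supported_units k n le).
Proof.
move=> rfl tr le_e; exists gamma, (fun g => mat (linear_subst g)); split.
- split=> i j; apply: polynomial_regular_on.
    exact: mx_linear_part_polynomial.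
  exact: substitution_mx_lin_polynomial.
- by move=> _ [g ge <-]; rewrite (mx_linear_part_mat_lin sB).
- by move=> g ge; exists g.
- move=> _ _ [g [_ gs] <-] [h _ <-].
  have gs' : mx_supported (root_le e) g by move=> i j /gs /le_e.
  by rewrite -(substitution_mx_linM e_sym sB h gs') !(mx_linear_part_mat_lin sB).
- by split=> [_ [g ge <-]|g ge]; rewrite (mx_linear_part_mat_lin sB).
Qed.

(** The image y_j of x_j has zero constant term because y_j^3 lies in I. *)
Lemma AutA_substitution M : AutA I B M ->
  exists2 y, [/\ preserves e y, zero_const y & linear_part y \in unitmx] & M = mat y.
Proof.
have const0 y : preserves e y -> zero_const y.
  move=> yI j; have : ('X_j : {mpoly k[n]}) ^+ 3 \in I.
    by rewrite mpolyXn edge_idealX /standard_mnm mdegMn mdeg1.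
  move=> /yI /edge_idealP /(_ _ (standard_mnm0 e)) /eqP.
  rewrite !rmorphXn /= substX.
  by rewrite expf_eq0 => /eqP.
move=> /(AutAP sB)[y [z [[yI zI yz] ->]]]; exists y => //; split=> //.
  exact: const0.
have := congr1 gamma yz; rewrite (mx_linear_part_id sB) (mx_linear_partM sB) //; last exact: const0.
by case/mulmx1_unit.
Qed.

Hypothesis component_le : forall X : set 'M[k]_N, X `<=` AutA I B -> zariski_connected X ->
  X 1%:M -> forall M, X M -> mx_supported (root_le e) (gamma M).

Lemma identity_component_AutA : identity_component (AutA I B) = autos.
Proof.
apply/seteqP; split=> [M [X [Xsub Xc X1 XM]]|].
  have Ms := component_le Xsub Xc X1 XM.
  have [y [yI y0 yu] ME] := AutA_substitution (Xsub _ XM).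
  exists y => //; split=> //.
  by move: Ms; rewrite ME (mx_linear_part_mat sB).
apply: closed_sub_identity_component.
- exact: (supported_autos_AutA e_sym sB).
- exact: supported_autos_connected.
- by have [] := supported_autos_subgroup e_sym sB.
Qed.

Lemma AutA_levi : levi_subgroup_iso (AutA I B) (@supported_units k n block_rel).
Proof.
have rfl := @same_block_refl n b; have tr := @same_block_trans n b.
apply: (@levi_subgroup_iso_of _ _ _ _ (linear_autos block_rel) uni).
- by rewrite identity_component_AutA; apply: supported_autos_subgroup.
- exact: supported_units_subgroup.
- exact: block_autos_reductive.
- by rewrite identity_component_AutA; apply: unipotent_autos_radical.
- by rewrite identity_component_AutA; apply: supported_autos_semidirect.
- by apply: linear_automorphisms_iso => //; apply: same_block_sub_root_le.
Qed.

End Radical.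

(** * The subgroup generated by the torus, the toric automorphisms and the roots *)

Section RootDerivations.
Variables (k : closedFieldType) (n : nat) (i j : 'I_n).
Hypothesis char_k : [pchar k] =i pred0.
Hypothesis ij : i != j.
Implicit Types (p q : {mpoly k[n]}) (m : 'X_{1..n}) (t c : k).

Definition root_der p : {mpoly k[n]} := 'X_i * p^`M(j).

Definition transvection c : 'M[k]_n := 1%:M + c *: delta_mx i j.

Lemma lin_transvection c s :
  linear_subst (transvection c) s = 'X_s + (c * (s == j)%:R) *: 'X_i.
Proof.
rewrite /linear_subst (eq_bigr (fun i' => (i' == s)%:R *: 'X_i' +
    (c * ((i' == i) && (s == j))%:R) *: 'X_i')); last first.
  by move=> i' _; rewrite !mxE scalerDl.
rewrite big_split /=; congr (_ + _).
  rewrite (bigD1 s) //= eqxx scale1r big1 ?addr0 // => i' /negPf ->.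
  by rewrite scale0r.
rewrite (bigD1 i) //= eqxx big1 ?addr0 // => i' /negPf ->.
by rewrite mulr0 scale0r.
Qed.

Lemma root_der_mnm m l : iter l root_der 'X_[m] =
  ((m j) ^_ l)%:R *: 'X_[m - U_(j) *+ l + U_(i) *+ l].
Proof.
elim: l => [|l IHl].
  rewrite /= ffactn0 scale1r; congr 'X_[_]; apply/mnmP => s.
  by rewrite mnmDE mnmBE !mulmnE !muln0 subn0 addn0.
rewrite iterS IHl /root_der mderivZ mderivX scalerA -scalerAr -mpolyXD -natrM.
congr (_%:R *: 'X_[_]).
  rewrite ffactnSr mnmDE mnmBE !mulmnE !mnm1E eqxx (negPf ij) mul1n mul0n addn0.
  by [].
apply/mnmP => s; rewrite !(mnmDE, mnmBE, mulmnE, mnm1E).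
case: (eqVneq i s) => [<-|_]; first by rewrite [j == i]eq_sym (negPf ij) /=; lia.
by case: (j == s); lia.
Qed.

(** Taylor's formula for the translation x_j |-> x_j + c x_i. The sum may be
    extended beyond the degree in x_j, where the derivatives vanish. *)
Lemma subst_transvection_mnm c m N : (m j < N)%N ->
  subst (linear_subst (transvection c)) 'X_[m] =
  \sum_(l < N) (c ^+ l / l`!%:R) *: iter l root_der 'X_[m].
Proof.
move=> mN; set a := m j in mN *; pose m0 := (m - U_(j) *+ a)%MM.
have mE : m = (U_(j) *+ a + m0)%MM.
  by apply/mnmP => s; rewrite !(mnmDE, mnmBE, mulmnE, mnm1E); case: eqP => [<-|_]; lia.
have m0j : m0 j = 0%N by rewrite mnmBE mulmnE mnm1E eqxx mul1n subnn.
have sm0 : subst (linear_subst (transvection c)) 'X_[m0] = 'X_[m0].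
  rewrite subst_mnm [RHS]mpolyXE_id; apply: eq_bigr => s _.
  have [->|sj] := eqVneq s j; first by rewrite m0j !expr0.
  by rewrite lin_transvection (negPf sj) mulr0 scale0r addr0.
have fact_nz l : (l`!%:R : k) != 0.
  have /pcharf0P-> := char_k.
  by rewrite -lt0n fact_gt0.
rewrite [X in subst _ 'X_[X]]mE mpolyXD -mpolyXn rmorphM rmorphXn /= substX sm0.
rewrite lin_transvection eqxx mulr1 exprDn mulr_suml.
rewrite (big_ord_widen N (fun l => 'X_j ^+ (a - l) * (c *: 'X_i) ^+ l *+ 'C(a, l) * 'X_[m0])) //.
rewrite [RHS](bigID (fun l : 'I_N => (l < a.+1)%N)) /= [X in _ = _ + X]big1 => [|l]; last first.
  by rewrite -leqNgt => al; rewrite root_der_mnm ffact_small ?scale0r ?scaler0.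
rewrite addr0; apply: eq_bigr => l; rewrite ltnS => la.
rewrite root_der_mnm scalerA exprZn.
have -> : (m - U_(j) *+ l + U_(i) *+ l)%MM = (U_(j) *+ (a - l) + U_(i) *+ l + m0)%MM.
  by apply/mnmP => s; rewrite !(mnmDE, mnmBE, mulmnE, mnm1E); case: eqP => [<-|_]; lia.
rewrite !mpolyXD -!mpolyXn -bin_ffact natrM mulrCA mulrA.
by rewrite -mulrA divfK // -scalerAr -scaler_nat -!scalerAl scalerA.
Qed.

Variables (e : rel 'I_n) (B : seq 'X_{1..n}).
Local Notation I := (edge_ideal k e).
Local Notation A := {ideal_quot I}.
Hypothesis sB : standard_monomials I B.

(** The exponential of the derivation x_i d/dx_j is x_j |-> x_j + c x_i. Its
    series is cut at the dimension of A, which exceeds 2 since 1, x_i and x_j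
    are independent. *)
Lemma nilpotent_exp_root c (d : A -> A) D :
  (forall p, d (\pi_A p) = \pi_A (root_der p)) ->
  is_matrix_of (B := B) d D ->
  nilpotent_exp (c *: D) = substitution_mx B (linear_subst (transvection c)).
Proof.
move=> dE DE.
have dM p q : \pi_A p = \pi_A q -> \pi_A (root_der p) = \pi_A (root_der q).
  by rewrite -!dE => ->.
have dZ c' p : root_der (c' *: p) = c' *: root_der p.
  by rewrite /root_der mderivZ scalerAr.
have dsum (J : Type) (s : seq J) (F : J -> {mpoly k[n]}) :
    root_der (\sum_(l <- s) F l) = \sum_(l <- s) root_der (F l).
  by rewrite /root_der raddf_sum mulr_sumr.
have DlE l s : \pi_A (iter l root_der 'X_[basis_mnm (B := B) s]) =
    \pi_A (\sum_a (D ^+ l) a s *: 'X_[basis_mnm (B := B) a]).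
  elim: l => [|l IHl].
    congr (\pi_A _); rewrite (bigD1 s) //= expr0 mxE eqxx scale1r big1 ?addr0 // => a /negPf a_s.
    by rewrite mxE a_s scale0r.
  rewrite iterS (dM _ _ IHl) dsum exprS raddf_sum /=.
  under eq_bigr do rewrite dZ pi_scale.
  have Dpi a : \pi_A (root_der 'X_[basis_mnm (B := B) a]) =
      \pi_A (\sum_b D b a *: 'X_[basis_mnm (B := B) b]).
    by rewrite -DE dE.
  under eq_bigr do rewrite Dpi -pi_scale scaler_sumr.
  rewrite -raddf_sum exchange_big; congr (\pi_A _); apply: eq_bigr => b _.
  rewrite mxE scaler_suml; apply: eq_bigr => a _.
  by rewrite scalerA mulrC.
have N3 : (2 < size B)%N.
  have /uniq_leq_size : uniq [:: 0%MM; U_(i)%MM; U_(j)%MM].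
    rewrite /= !inE negb_or ![0%MM == _]eq_sym !mnm1_eq0 eq_mnm1 (negPf ij).
    by [].
  apply=> m; rewrite !inE (mem_basis sB) => /or3P[] /eqP ->.
  - exact: standard_mnm0.
  - exact: standard_mnm1.
  - exact: standard_mnm1.
apply/matrixP => a s; rewrite mxE summxE.
have sm := basis_mnm_standard sB s.
have mN : (basis_mnm (B := B) s j < size B)%N.
  apply: leq_ltn_trans N3; case/andP: sm; rewrite ltnS => m2 _.
  by apply: leq_trans m2; rewrite mdegE (bigD1 j) //= leq_addr.
rewrite (subst_transvection_mnm c mN) raddf_sum /=; apply: eq_bigr => l _.
have /(pi_basisP sB) /(_ a) := DlE l s; rewrite (mcoeff_basis_sum sB) => DlE'.
have -> : (c *: D) ^+ l = c ^+ l *: D ^+ l.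
  elim: (nat_of_ord l) => [|t IHt]; first by rewrite !expr0 scale1r.
  rewrite !exprS IHt; change ((c *: D) *m (c ^+ t *: D ^+ t) = (c * c ^+ t) *: (D *m D ^+ t)).
  by rewrite -scalemxAl -scalemxAr scalerA.
rewrite mcoeffZ DlE' !mxE mulrA; congr (_ * _).
by rewrite mulrC.
Qed.

End RootDerivations.
Section GroupG1.
Variables (k : closedFieldType) (n : nat) (e : rel 'I_n) (B : seq 'X_{1..n}).
Local Notation I := (edge_ideal k e).
Local Notation A := {ideal_quot I}.
Local Notation N := (size B).
Hypothesis e_sym : ssrbool.symmetric e.
Hypothesis sB : standard_monomials I B.
Hypothesis char_k : [pchar k] =i pred0.
Implicit Types (M : 'M[k]_N) (g h : 'M[k]_n).
Local Notation mat := (@substitution_mx k n B).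
Local Notation gamma := (@mx_linear_part k n B).
Local Notation linear_autos := (@linear_automorphisms k n B).

(** Apply the derivation to the relation x_j x_c; for c = j the factor 2 is
    invertible. *)
Lemma is_root0_le i j : is_root0 I i j -> root_le e i j.
Proof.
move=> [ij dI]; apply/root_leP => c ejc.
have two : (2%:R : k) != 0 by have /pcharf0P-> := char_k.
have : 'X_j * 'X_c \in I by rewrite edge_idealXX.
move/dI; rewrite mderivM mderivX [X in _ + _ * X]mderivX !mnm1E eqxx scale1r.
have -> : (U_(j) - U_(j))%MM = 0%MM :> 'X_{1..n} by apply/mnmP => s; rewrite mnmBE mnm0E subnn.
rewrite mpolyX0 mul1r.
have [cj|cj] := eqVneq c j.
  rewrite cj scale1r (_ : (U_(j) - U_(j))%MM = 0%MM :> 'X_{1..n}); last first.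
    by apply/mnmP => s; rewrite mnmBE mnm0E subnn.
  rewrite mpolyX0 mulr1 -mulr2n mulrnAr -scaler_nat.
  move/(idealMr ((2%:R)^-1)%:MP); rewrite mul_mpolyC scalerA mulVf // scale1r.
  by rewrite edge_idealXX.
by rewrite scale0r mulr0 addr0 edge_idealXX.
Qed.

(** The derivation replaces one factor x_j of a monomial by x_i. If the
    monomial is divisible by a relation x_a x_c, either the factor can be taken
    outside of it, or the relation becomes x_i x_c or x_a x_i. *)
Lemma root_le_is_root0 i j : i != j -> root_le e i j -> is_root0 I i j.
Proof.
move=> ij /root_leP le_ij; split=> // p pI.
rewrite [p]mpolyE raddf_sum mulr_sumr big_seq; apply: rpred_sum => m mp /=.
have: ~~ standard_mnm e m by apply: (allP pI).
rewrite mderivZ mderivX -!scalerAr -mpolyXD => sm.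
case: (posnP (m j)) => [-> | mj]; first by rewrite scale0r scaler0 rpred0.
rewrite -!mul_mpolyC; do 2!apply: idealMr; rewrite edge_idealX.
move: sm; rewrite !negb_and => /orP[m3|].
  apply/orP; left; move: m3; rewrite -!leqNgt => m3; apply: leq_trans m3 _.
  have mE : m = (U_(j) + (m - U_(j)))%MM.
    by apply/mnmP => s; rewrite mnmDE mnmBE mnm1E subnKC //; case: eqP => [<-|].
  by rewrite {1}mE !mdegD !mdeg1.
rewrite negb_forall => /existsP[a]; rewrite negb_forall => /existsP[c].
rewrite negb_imply negbK => /andP[eac /mnm_lepP acm]; apply/orP; right.
have keep a' c' : e a' c' -> (U_(a') + U_(c') <= U_(i) + (m - U_(j)))%MM ->
   ~~ [forall i0, forall j0, e i0 j0 ==> ~~ (U_(i0) + U_(j0) <= U_(i) + (m - U_(j)))%MM].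
  move=> eac' H; rewrite negb_forall; apply/existsP; exists a'.
  by rewrite negb_forall; apply/existsP; exists c'; rewrite eac' /= negbK; exact: H.
have [ja|ja] := eqVneq a j.
  apply: (keep i c); first by apply: le_ij; rewrite -ja.
  apply/mnm_lepP => s; move: (acm s); rewrite !(mnmDE, mnmBE, mnm1E) ja.
  by lia.
have [jc|jc] := eqVneq c j.
  apply: (keep a i); first by rewrite e_sym; apply: le_ij; rewrite -jc e_sym.
  apply/mnm_lepP => s; move: (acm s); rewrite !(mnmDE, mnmBE, mnm1E) jc.
  by lia.
apply: (keep a c) => //; apply/mnm_lepP => s; move: (acm s); rewrite !(mnmDE, mnmBE, mnm1E).
have [<-|] := eqVneq j s; last by lia.
by rewrite (negPf ja) (negPf jc).
Qed.

Lemma transvection_supported i j c : root_le e i j ->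
  mx_supported (root_le e) (transvection i j c : 'M[k]_n).
Proof.
move=> ij a s; rewrite !mxE; have [->|_] := eqVneq a s; first by rewrite root_le_refl.
by rewrite add0r; case: andP => [[/eqP -> /eqP ->] //|_]; rewrite mulr0 eqxx.
Qed.

Lemma transvection_unit i j c : i != j -> (transvection i j c : 'M[k]_n) \in unitmx.
Proof. by move=> ij; have /mulmx1_unit[] := @transvection_inv k n i j c ij. Qed.

(** This subgroup contains the generators of G_1. Here the linear part is not
    restricted to the preorder, because toric automorphisms may permute blocks.
    *)
Definition linear_AutA : set 'M[k]_N := [set M | AutA I B M /\ exists g, M = mat (linear_subst g)].

Lemma linear_AutA_subgroup : is_subgroup linear_AutA.
Proof.
have [Au A1 AM AV] := AutA_subgroup sB.
have pres g : AutA I B (mat (linear_subst g)) -> preserves e (linear_subst g) /\ g \in unitmx.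
  move=> /(AutA_substitution sB)[y [yI y0 yu] yE]; split.
    apply: preserves_ext yI => s; apply/esym; exact: (substitution_mx_inj sB).
  by have := congr1 gamma yE; rewrite (mx_linear_part_mat_lin sB) (mx_linear_part_mat sB) => ->.
have matM g h : AutA I B (mat (linear_subst g)) -> mat (linear_subst g) *m mat (linear_subst h) = mat (linear_subst (g *m h)).
  move=> /pres[gI _]; rewrite -(substitution_mx_comp sB (linear_subst h) gI).
  by congr (substitution_mx _); apply/funext => s; rewrite subst_lin_lin.
split.
- by move=> M [/Au].
- by split=> //; exists 1%:M; rewrite (substitution_mx_lin1 sB).
- move=> M M' [Ag [g gE]] [Ah [h hE]]; split; first exact: AM.
  by rewrite gE in Ag *; rewrite hE; exists (g *m h); exact: matM.
- move=> M [Ag [g gE]]; split; first exact: AV.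
  rewrite gE in Ag *; exists (invmx g); have [_ gu] := pres g Ag.
  apply: (can_inj (mulKmx (Au _ Ag))).
  by rewrite (mulmxV (Au _ Ag)) (matM _ _ Ag) (mulmxV gu) (substitution_mx_lin1 sB).
Qed.

Lemma lin_diag (t : 'rV[k]_n) j : linear_subst (diag_mx t) j = t 0 j *: 'X_j.
Proof.
rewrite /linear_subst (bigD1 j) //= mxE eqxx mulr1n big1 ?addr0 // => s sj.
by rewrite mxE (negPf sj) mulr0n scale0r.
Qed.

Lemma lin_perm (s : 'S_n) j : linear_subst (\matrix_(a, c) (a == s c)%:R) j = 'X_(s j) :> {mpoly k[n]}.
Proof.
rewrite /linear_subst (bigD1 (s j)) //= mxE eqxx scale1r big1 ?addr0 // => a aj.
by rewrite mxE (negPf aj) scale0r.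
Qed.

Lemma is_matrix_of_lin (f : {rmorphism A -> A}) M g :
  is_algebra_automorphism f -> is_matrix_of f M ->
  (forall i, f (\pi_A 'X_i) = \pi_A (linear_subst g i)) -> M = mat (linear_subst g).
Proof.
move=> [_ fC] fM fX; apply: ((is_matrix_ofP sB _ _).1 fM).
exact: rmorphism_subst.
Qed.

Lemma G1_linear_AutA : G1 I B `<=` linear_AutA.
Proof.
move=> M; apply; first exact: linear_AutA_subgroup.
move=> {}M [[[f [t [fa fM _ fX]]]|[f [s [fa fM _ fX]]]]|[i [j [root [d [D [t [dE DE ->]]]]]]]].
- split; first by exists f.
  exists (diag_mx (\row_i t i)); apply: is_matrix_of_lin fa fM _ => i.
  by rewrite fX lin_diag mxE.
- split; first by exists f.
  exists (\matrix_(a, c) (a == s c)%:R); apply: is_matrix_of_lin fa fM _ => i.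
  by rewrite fX lin_perm.
have ij : i != j by case: root.
have le_ij := is_root0_le root.
rewrite (nilpotent_exp_root (i := i) (j := j) char_k ij sB t dE DE).
split; last by eexists.
apply: (admissible_AutA e_sym sB); apply: admissible_lin.
  exact: transvection_supported.
exact: transvection_unit.
Qed.

Lemma linear_automorphisms_G1 : linear_autos (root_le e) `<=` G1 I B.
Proof.
have rfl := @root_le_refl n e; have tr := @root_le_trans n e.
have inAut g : mx_supported (root_le e) g -> g \in unitmx -> AutA I B (mat (linear_subst g)).
  by move=> gs gu; apply: (admissible_AutA e_sym sB); apply: admissible_lin.
move=> _ [g [gu gs] <-].
suff [] : [/\ mx_supported (root_le e) g, g \in unitmx & G1 I B (mat (linear_subst g))] by [].
apply: (@supported_unit_gen k n (root_le e)
  (fun g => [/\ mx_supported (root_le e) g, g \in unitmx & G1 I B (mat (linear_subst g))])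
  rfl tr _ _ _ g gu gs).
- move=> {gu gs}g h [gs gu gG] [hs hu hG]; split; first exact: mx_supportedM.
    by rewrite unitmx_mul gu.
  rewrite (substitution_mx_linM e_sym sB h gs) => H Hg HS; have [_ _ HM _] := Hg.
  by apply: HM; [apply: gG | apply: hG].
- move=> t t0.
  have ts : mx_supported (root_le e) (diag_mx t).
    by move=> a c; rewrite mxE; have [->|] := eqVneq a c; rewrite ?rfl // mulr0n eqxx.
  have tu : diag_mx t \in unitmx.
    by rewrite unitmxE unitfE det_diag; apply/prodf_neq0 => a _.
  split=> // H Hg; apply; left; left; have [f fa fM] := inAut _ ts tu.
  exists f, (t 0); split=> // a.
  by rewrite (column_image_of sB _ fM) (column_image_mat sB) lin_diag.
- move=> i j c ij nij; split; [exact: transvection_supported | exact: transvection_unit |].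
  have root := root_le_is_root0 nij ij.
  move=> H Hg; apply; right; exists i, j; split=> //.
  pose d (a : A) : A := \pi_A (root_der i j (repr a)).
  have dE p : d (\pi_A p) = \pi_A (root_der i j p).
    apply/pi_eqP; rewrite /root_der -mulrBr -mderivB; apply: root.2.
    by apply/pi_eqP; rewrite reprK.
  pose D : 'M[k]_N := \matrix_(a, s) (root_der i j 'X_[basis_mnm s])@_(basis_mnm a).
  have DE : is_matrix_of d D.
    move=> s; rewrite dE; apply/(pi_basisP sB) => a.
    by rewrite (mcoeff_basis_sum sB (fun a => D a s)) mxE.
  exists d, D, c; split=> //.
  by rewrite (nilpotent_exp_root (i := i) (j := j) char_k nij sB c dE DE).
Qed.

Hypothesis component_le : forall X : set 'M[k]_N, X `<=` AutA I B -> zariski_connected X ->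
  X 1%:M -> forall M, X M -> mx_supported (root_le e) (gamma M).

Lemma identity_component_G1 : identity_component (G1 I B) = linear_autos (root_le e).
Proof.
have rfl := @root_le_refl n e; have tr := @root_le_trans n e.
apply/seteqP; split=> [M [X [Xsub Xc X1 XM]]|].
  have Xaut : X `<=` AutA I B by move=> x /Xsub /G1_linear_AutA [].
  have Ms := component_le Xaut Xc X1 XM.
  have [MA [g ME]] := G1_linear_AutA (Xsub _ XM).
  have [y [_ _ yu] yE] := AutA_substitution sB MA.
  exists g => //; move: Ms yu; rewrite ME (mx_linear_part_mat_lin sB) => gs yu; split=> //.
  by have := congr1 gamma yE; rewrite ME (mx_linear_part_mat_lin sB) (mx_linear_part_mat sB) => ->.
apply: closed_sub_identity_component.
- exact: linear_automorphisms_G1.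
- exact: (linear_automorphisms_connected sB).
- by have [] := linear_automorphisms_subgroup e_sym sB rfl tr (fun _ _ H => H).
Qed.

End GroupG1.

(** * The two graphs *)

Section ProductsOfLinearForms.
Variables (k : fieldType) (n : nat).
Implicit Types (g h : 'M[k]_n).

Lemma eq_mnm1D (a c i j : 'I_n) : (U_(a) + U_(c) == U_(i) + U_(j))%MM =
  ((a == i) && (c == j)) || ((a == j) && (c == i)).
Proof.
apply/eqP/orP => [/mnm1D_inj[[-> ->]|[-> ->]]|[/andP[/eqP -> /eqP ->]|/andP[/eqP -> /eqP ->]]] //.
- by left; rewrite !eqxx.
- by right; rewrite !eqxx.
- by rewrite addmC.
Qed.

(** For i = j the second product would count the same term twice. *)
Lemma mcoeff_lin_mul g h s t i j : (linear_subst g s * linear_subst h t)@_(U_(i) + U_(j))%MM =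
  g i s * h j t + (if i == j then 0 else g j s * h i t).
Proof.
rewrite mulr_suml raddf_sum /=.
under eq_bigr => a _.
  rewrite mulr_sumr raddf_sum /=.
  under eq_bigr => c _.
    rewrite -scalerAl -scalerAr scalerA mcoeffZ -mpolyXD mcoeffX eq_mnm1D.
    over.
  over.
have delta (a1 c1 : 'I_n) : \sum_a \sum_c g a s * h c t * ((a == a1) && (c == c1))%:R =
    g a1 s * h c1 t.
  rewrite (bigD1 a1) //= [X in _ + X]big1 => [|a /negPf aa]; last first.
    by rewrite big1 // => c _; rewrite aa mulr0.
  rewrite addr0 (bigD1 c1) //= big1 => [|c /negPf cc]; last by rewrite cc andbF mulr0.
  by rewrite !eqxx mulr1 addr0.
have [ij|ij] := eqVneq i j.
  by rewrite ij addr0 -delta; apply: eq_bigr => a _; apply: eq_bigr => c _; rewrite orbb.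
rewrite -!delta -big_split; apply: eq_bigr => a _ /=; rewrite -big_split.
apply: eq_bigr => c _ /=; rewrite -mulrDr -natrD; congr (_ * _%:R).
have [->|] := eqVneq a i; last by rewrite !add0n.
by rewrite (negPf ij) orbF addn0.
Qed.

End ProductsOfLinearForms.

Section Graphs.
Variables (k : closedFieldType) (n : nat) (e : rel 'I_n) (B : seq 'X_{1..n}).
Local Notation I := (edge_ideal k e).
Local Notation N := (size B).
Hypothesis e_sym : ssrbool.symmetric e.
Hypothesis sB : standard_monomials I B.
Implicit Types (y z : 'I_n -> {mpoly k[n]}) (M : 'M[k]_N) (g h d : 'M[k]_n).
Local Notation mat := (@substitution_mx k n B).
Local Notation gamma := (@mx_linear_part k n B).

Lemma AutA_linear_part M : AutA I B M -> gamma M \in unitmx /\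
  forall j l i i', e j l -> ~~ e i i' -> gamma M i j * gamma M i' l +
    (if i == i' then 0 else gamma M i' j * gamma M i l) = 0.
Proof.
move=> /(AutA_substitution sB)[y [yI y0 yu] ->]; rewrite (mx_linear_part_mat sB); split=> //.
move=> j l i i' ejl nii'; rewrite -mcoeff_lin_mul; move: nii'.
rewrite -(standard_mnm2 _ _ e_sym); apply/edge_idealP.
rewrite -(mul_edge_ideal_linear_part e) //.
by have := yI ('X_j * 'X_l); rewrite rmorphM /= !substX; apply; rewrite edge_idealXX.
Qed.

Section SameBlock.
Variable b : 'I_n -> nat.
Hypothesis char_k : [pchar k] =i pred0.
Hypothesis eE : forall i j, e i j = (b i == b j).

Lemma same_block_root_le i j : root_le e i j = (b i == b j).
Proof.
apply/root_leP/eqP => [/(_ j)|bij c]; first by rewrite !eE eqxx => /(_ isT) /eqP.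
by rewrite !eE bij.
Qed.

(** For a and c in different blocks, the coefficient of x_a x_c in the square
    of the image of x_j is 2 g_aj g_cj, so column j of the linear part is zero
    outside its block j or inside it. Both conditions are closed and exclude
    each other, and the identity satisfies the first. *)
Lemma same_block_component (X : set 'M[k]_N) : X `<=` AutA I B -> zariski_connected X ->
  X 1%:M -> forall M, X M -> mx_supported (root_le e) (gamma M).
Proof.
move=> Xsub Xc X1 M XM i j; rewrite same_block_root_le; apply: contraNT => bij.
have alg := @polynomial_fun_algebra k N.
have closedZ (D : set 'I_n) : zariski_closed [set M | forall i, D i -> gamma M i j = 0].
  by apply: zariski_closed_zeros => a _; apply: mx_linear_part_polynomial.
have /(_ _ XM i bij) -> // : X `<=` [set M | forall i, b i != b j -> gamma M i j = 0].
apply: (zariski_connected_sub Xc (closedZ [set i | b i != b j])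
  (closedZ [set i | b i == b j]) _ _ X1).
- move=> M' /Xsub /AutA_linear_part [_ M'e].
  have [[a [ba ga]]|H] := pselect (exists a, b a == b j /\ gamma M' a j != 0); [left|right].
    move=> c /= bc; apply/eqP.
    have ac : a != c by apply: contraNneq bc => <-.
    have two : (2%:R : k) != 0 by have /pcharf0P-> := char_k.
    have := M'e j j a c; rewrite !eE eqxx (negPf ac) (eqP ba) eq_sym bc => /(_ isT isT) /eqP.
    rewrite [gamma M' c j * _]mulrC -mulr2n -mulr_natl !mulf_eq0 (negPf two) (negPf ga).
    by [].
  move=> a /= ba; apply/eqP; apply: contrapT => ga; apply: H.
  by exists a; split=> //; apply/negP.
- rewrite -subset0 => M' [[/Xsub /AutA_linear_part [M'u _] Z1] Z2].
  have : (invmx (gamma M') *m gamma M') j j = 0.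
    rewrite mxE big1 // => a _; have [ba|ba] := eqVneq (b a) (b j).
      by rewrite (Z2 a) ?mulr0 //=; apply/eqP.
    by rewrite (Z1 a) ?mulr0.
  by rewrite mulVmx // mxE eqxx => /eqP; rewrite oner_eq0.
- by move=> a /= ba; rewrite (mx_linear_part_id sB) mxE; have [aj|//] := eqVneq a j; rewrite aj eqxx in ba.
Qed.

End SameBlock.

Section Threshold.
Variables (b : 'I_n -> nat) (r : nat).
Hypothesis b_lt : forall i, (b i < r)%N.
Hypothesis b_mono : forall i j : 'I_n, (i <= j)%N -> (b i <= b j)%N.
Hypothesis b_surj : forall s, (s < r)%N -> exists i, b i = s.
Hypothesis eE : forall i j, e i j = (b i + b j < r)%N.

Lemma threshold_root_le i j : root_le e i j = (b i <= b j)%N.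
Proof.
apply/root_leP/idP => [H|bij c]; last by rewrite !eE; lia.
have [c cE] := b_surj (s := r.-1 - b j) ltac:(have := b_lt j; lia).
by have := H c; rewrite !eE cE; have := b_lt j; have := b_lt i; lia.
Qed.

(** Suppose g_(i0) j is nonzero with b i0 > b j. If b l + b j < r, then x_l
    annihilates x_j, so the product of their images vanishes in A. Looking at
    the last variables i1 and i2 of these images, the coefficient of x_i1 x_i2
    in the product is nonzero, so e i1 i2 holds, and column l is supported in
    the blocks below r - b i0. These are too few rows for the columns l with b
    l < r - b j. *)
Lemma threshold_linear_part M : AutA I B M -> mx_supported (root_le e) (gamma M).
Proof.
move=> /AutA_linear_part[]; move: (gamma M) => g gu ge i0 j gij.
rewrite threshold_root_le leqNgt; apply/negP => bji.
pose S := [set l | (b l + b j < r)%N]%SET; pose T := [set l | (b l + b i0 < r)%N]%SET.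
have : (#|S| <= #|T|)%N.
  apply: (unitmx_col_count gu) => i' l; rewrite !inE => bl gi'l.
  have [i1 g1 max1] := @arg_maxnP _ i0 (fun i => g i j != 0) (@nat_of_ord n) gij.
  have [i2 g2 max2] := @arg_maxnP _ i' (fun i => g i l != 0) (@nat_of_ord n) gi'l.
  have H : e i1 i2.
    apply: contraT => /(ge j l i1 i2); rewrite eE addnC bl => /(_ isT) /eqP.
    rewrite (_ : (if _ then _ else _) = 0) ?addr0 ?mulf_eq0 ?(negPf g1) ?(negPf g2) //.
    case: eqVneq => // i12; apply/eqP; rewrite mulf_eq0.
    apply: contraNT i12; rewrite negb_or => /andP[/max1 h1 /max2 h2].
    by apply/eqP/val_inj/anti_leq/andP.
  move: H; rewrite eE; have := b_mono (max1 _ gij); have := b_mono (max2 _ gi'l).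
  by rewrite /=; lia.
apply/negP; rewrite -ltnNge; apply: proper_card; apply/fintype.properP; split.
  by apply/fintype.subsetP => l; rewrite !inE; lia.
have [c cE] := b_surj (s := r.-1 - b j) ltac:(have := b_lt j; lia).
by exists c; rewrite !inE cE; have := b_lt j; have := b_lt i0; lia.
Qed.

End Threshold.
End Graphs.

(** * Standard Levi and parabolic subgroups *)

Section StandardSubgroups.
Variables (k : fieldType) (r : nat) (m : 'I_r -> nat).
Local Notation n := (\sum_j m j)%N.

Definition block_index (i : 'I_n) : nat := tagnat.sig1 i.

Lemma block_index_lt i : (block_index i < r)%N. Proof. exact: ltn_ord. Qed.

Lemma block_index_mono (i j : 'I_n) : (i <= j)%N -> (block_index i <= block_index j)%N.
Proof. exact: tagnat.le_sig1. Qed.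

Lemma block_index_surj : (forall j, (0 < m j)%N) ->
  forall s, (s < r)%N -> exists i, block_index i = s.
Proof.
move=> m_gt0 s sr; exists (tagnat.Rank (Ordinal sr) (Ordinal (m_gt0 (Ordinal sr)))).
by rewrite /block_index tagnat.Rank1K.
Qed.

Lemma mxdiagM (C D : forall j, 'M[k]_(m j)) :
  \mxdiag_j C j *m \mxdiag_j D j = \mxdiag_j (C j *m D j).
Proof.
rewrite {2}/mxdiag mul_mxdiag_mxblock; apply/eq_mxblock => i j.
by case: eqP => [<-|_]; rewrite ?conform_mx_id ?mulmx0.
Qed.

Lemma mxdiag_submxblock (x : 'M[k]_n) : mx_supported (same_block block_index) x ->
  x = \mxdiag_j (submxblock x j j).
Proof.
move=> xs; rewrite -[LHS]submxblockK; apply/eq_mxblock => i j.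
case: eqVneq => [<-|ij]; first by rewrite conform_mx_id.
apply/matrixP => a c; rewrite !mxE; apply: (mx_supported0 xs).
by rewrite /same_block /block_index !tagnat.Rank1K.
Qed.

Lemma mxdiag_supported (C : forall j, 'M[k]_(m j)) :
  mx_supported (same_block block_index) (\mxdiag_j C j).
Proof.
move=> s t; rewrite /same_block /block_index val_eqE; apply: contraNT => st.
by rewrite !mxE (negPf st) mxE.
Qed.

Lemma standard_leviE : standard_levi k m = supported_units (same_block block_index).
Proof.
apply/seteqP; split=> [_ [C Cu ->]|x [xu xs]].
  split; last exact: mxdiag_supported.
  have : \mxdiag_j C j *m \mxdiag_j invmx (C j) = 1%:M.
    rewrite mxdiagM -mxdiagZ; apply: eq_mxdiag => j.
    by rewrite mulmxV.
  by case/mulmx1_unit.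
have xVs := mx_supportedV (@same_block_refl _ _) (@same_block_trans _ _) xu xs.
exists (fun j => submxblock x j j); last exact: mxdiag_submxblock.
have : \mxdiag_j (submxblock x j j *m submxblock (invmx x) j j) =
    \mxdiag_j (1%:M : 'M[k]_(m j)).
  by rewrite -mxdiagM -!mxdiag_submxblock // mulmxV // mxdiagZ.
by move/eq_mxdiagP => xx j; case: (mulmx1_unit (xx j)).
Qed.

(** Both inclusions use generators: those of the parabolic are block upper
    triangular, and the diagonal matrices and transvections generating the
    block upper triangular matrices lie in L or in the unipotent upper
    triangular group. *)
Lemma standard_parabolicE :
  standard_parabolic k m = supported_units (fun i j => block_index i <= block_index j)%N.
Proof.
have rfl : reflexive (fun i j => block_index i <= block_index j)%N by move=> i /=.
have tr : transitive (fun i j => block_index i <= block_index j)%N.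
  by move=> j i l; apply: leq_trans.
apply/seteqP; split.
  move=> x; apply; first exact: supported_units_subgroup.
  rewrite standard_leviE => y [[yu ys]|[y1 y0]].
    by split=> // i j /ys /eqP ->.
  split.
    rewrite unitmxE -det_tr det_trig; last first.
      by apply/is_trig_mxP => i j ij; rewrite mxE y0.
    by rewrite big1 ?unitr1 // => i _; rewrite mxE y1.
  move=> i j; apply: contraNT; rewrite -ltnNge => ij; rewrite y0 //.
  by rewrite ltnNge; apply: contraTN ij => /block_index_mono; rewrite -leqNgt.
move=> x [xu xs] H Hg Hsub; have [_ _ HM _] := Hg.
have Hlevi y : y \in unitmx -> mx_supported (same_block block_index) y -> H y.
  by move=> yu ys; apply: Hsub; left; rewrite standard_leviE.
apply: (supported_unit_gen rfl tr HM) xu xs.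
  move=> t t0; apply: Hlevi.
    by rewrite unitmxE unitfE det_diag; apply/prodf_neq0 => a _.
  move=> i j; rewrite mxE; have [->|_] := eqVneq i j; first by rewrite same_block_refl.
  by rewrite mulr0n eqxx.
move=> i j c bij ij; have [bE|bN] := eqVneq (block_index i) (block_index j).
  apply: Hlevi; first by have /mulmx1_unit[] := @transvection_inv k n i j c ij.
  move=> a s; rewrite !mxE; have [->|_] := eqVneq a s; first by rewrite same_block_refl.
  rewrite add0r; case: andP => [[/eqP -> /eqP ->] _|_]; last by rewrite mulr0 eqxx.
  exact/eqP.
have lt_ij : (i < j)%N.
  by rewrite ltnNge; apply: contraNN bN => /block_index_mono ji; rewrite eqn_leq bij.
apply: Hsub; right; split=> [a|a s sa]; rewrite !mxE.
  rewrite eqxx; case: andP => [[/eqP -> /eqP ji]|_]; last by rewrite mulr0 addr0.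
  by rewrite ji eqxx in ij.
have [as_|_] := eqVneq a s; first by rewrite as_ ltnn in sa.
case: andP => [[/eqP ai /eqP sj]|_]; last by rewrite mulr0 addr0.
by move: sa; rewrite ai sj ltnNge (ltnW lt_ij).
Qed.

End StandardSubgroups.

(** The hypothesis on connected sets of automorphisms is the only point where
    the two graphs need separate arguments. *)
Lemma edge_ideal_realizes (k : closedFieldType) (char_k : [pchar k] =i pred0)
    (n : nat) (e : rel 'I_n) (b : 'I_n -> nat) :
  ssrbool.symmetric e ->
  (forall i j, root_le e i j -> (b i <= b j)%N) ->
  (forall i j, b i = b j -> root_le e i j) ->
  (forall B, standard_monomials (edge_ideal k e) B ->
    forall X : set 'M[k]_(size B), X `<=` AutA (edge_ideal k e) B ->
    zariski_connected X -> X 1%:M ->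
    forall M, X M -> mx_supported (root_le e) (mx_linear_part M)) ->
  [/\ monomial_ideal (edge_ideal k e), cofinite_support (edge_ideal k e),
      forall i : 'I_n, 'X_i \notin edge_ideal k e
    & forall B, standard_monomials (edge_ideal k e) B ->
      alg_iso (identity_component (G1 (edge_ideal k e) B))
        (@supported_units k n (root_le e)) /\
      levi_subgroup_iso (AutA (edge_ideal k e) B)
        (@supported_units k n (same_block b))].
Proof.
move=> e_sym le_b b_le comp; split.
- exact: edge_ideal_monomial.
- exact: edge_ideal_cofinite.
- exact: edge_ideal_var.
move=> B sB; split; last exact: (AutA_levi e_sym sB le_b b_le (comp B sB)).
rewrite (identity_component_G1 e_sym sB char_k (comp B sB)).
apply: (linear_automorphisms_iso e_sym sB) => //.
- exact: root_le_refl.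
- exact: root_le_trans.
Qed.

Theorem proposition2p8 (k : closedFieldType) (char_k : [pchar k] =i pred0)
    (r : nat) (m : 'I_r -> nat) (m_gt0 : forall j, (0 < m j)%N) :
  (exists I : idealr {mpoly k[\sum_j m j]},
    [/\ monomial_ideal I, cofinite_support I,
        forall i : 'I_(\sum_j m j), 'X_i \notin I
      & forall B, standard_monomials I B ->
          alg_iso (identity_component (G1 I B)) (standard_levi k m) /\
          levi_subgroup_iso (AutA I B) (standard_levi k m)]) /\
  (exists I : idealr {mpoly k[\sum_j m j]},
    [/\ monomial_ideal I, cofinite_support I,
        forall i : 'I_(\sum_j m j), 'X_i \notin I
      & forall B, standard_monomials I B ->
          alg_iso (identity_component (G1 I B)) (standard_parabolic k m) /\
          levi_subgroup_iso (AutA I B) (standard_levi k m)]).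
Proof.
have b_lt := @block_index_lt r m; have b_mono := @block_index_mono r m.
have b_surj := block_index_surj m_gt0.
rewrite standard_leviE standard_parabolicE; split.
  pose e : rel 'I_(\sum_j m j) := fun i j => block_index i == block_index j.
  have e_sym : ssrbool.symmetric e by move=> i j; apply: eq_sym.
  have leE := @same_block_root_le _ e (@block_index r m) (fun i j => erefl).
  have {1}-> : same_block (@block_index r m) = root_le e.
    by apply/funext => i; apply/funext => j; rewrite leE.
  exists (edge_ideal k e); apply: edge_ideal_realizes => //.
  - by move=> i j; rewrite leE => /eqP ->.
  - by move=> i j bij; rewrite leE bij.
  - by move=> B sB; apply: (same_block_component e_sym sB char_k (fun i j => erefl)).
pose e : rel 'I_(\sum_j m j) := fun i j => (block_index i + block_index j < r)%N.
have e_sym : ssrbool.symmetric e by move=> i j; rewrite /e addnC.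
have leE := @threshold_root_le _ e _ r b_lt b_surj (fun i j => erefl).
have -> : (fun i j => block_index i <= block_index j)%N = root_le e.
  by apply/funext => i; apply/funext => j; rewrite leE.
exists (edge_ideal k e); apply: edge_ideal_realizes => //.
- by move=> i j; rewrite leE.
- by move=> i j bij; rewrite leE bij.
- move=> B sB X Xsub _ _ M /Xsub.
  exact: (threshold_linear_part e_sym sB b_lt b_mono b_surj (fun i j => erefl)).
Qed.
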